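(* Let $\xi_i$ be i.i.d. Gaussian $\mathcal N(0,\sigma^2)$ random variables with $\sigma^2>0$ and assume $\beta\ge4\sigma^2$. Suppose that $\|\phi_j\|_n^2\le\phi_0$, $j=1,\dots,M$, for some constant $0<\phi_0<\infty$, and set $\tau=\frac{\sigma}{\sqrt{\phi_0nM}}$. Let $\hat f_n$ be the exponentially weighted aggregate on $\Lambda=\mathbb R^M$ with temperature $\beta$ and prior $\pi(d\lambda)=q(\lambda)\,d\lambda$. If there exists $\lambda^*\in\mathbb R^M$ such that $f=f_{\lambda^*}$, then $$E\big(\|\hat f_n-f\|_n^2\big)\le\frac{4\beta}{n}M(\lambda^* )\Big(1+\log_+\Big\{\frac{\sqrt{\phi_0nM}}{M(\lambda^* )\,\sigma}\,|\lambda^*|_1\Big\}\Big)+\frac{\sigma^2}{n},$$ where $|\lambda^*|_1=\sum_{j=1}^M|\lambda^*_j|$ and the first term on the right is interpreted as $0$ when $\lambda^*=0$.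
   Context: Model: $Y_i=f(x_i)+\xi_i$, $i=1,\dots,n$, where $x_1,\dots,x_n$ are non-random elements of a set $\mathcal X$ and $f:\mathcal X\to\mathbb R$ is an unknown function. Write $\mathbf Y=(Y_1,\dots,Y_n)$. Functions $\phi_1,\dots,\phi_M:\mathcal X\to\mathbb R$ are given, and $f_\lambda=\sum_{j=1}^M\lambda_j\phi_j$ for $\lambda\in\mathbb R^M$. $M(\lambda)$ is the number of non-zero components of $\lambda$. $\log_+x=\max(\log x,0)$ for $x>0$ (and $\log_+0=0$). For a function $g$ on $\mathcal X$, $\|g\|_n^2=\frac1n\sum_{i=1}^ng(x_i)^2$; for $\mathbf y\in\mathbb R^n$, $\|\mathbf y-f_\lambda\|_n^2=\frac1n\sum_{i=1}^n(y_i-f_\lambda(x_i))^2$. Sparsity prior (case $L_0=\infty$): $q(\lambda)=\prod_{j=1}^M\tau^{-1}q_0(\lambda_j/\tau)$, $\lambda\in\mathbb R^M$, with $q_0(t)=\frac{3}{2(1+|t|)^4}$, $t\in\mathbb R$. The exponentially weighted aggregate with prior $\pi$ and temperature $\beta$ is $$\hat f_n(x)=\int_{\mathbb R^M}\theta_\lambda(\mathbf Y)f_\lambda(x)\,\pi(d\lambda),\qquad\theta_\lambda(\mathbf Y)=\frac{\exp\{-n\|\mathbf Y-f_\lambda\|_n^2/\beta\}}{\int_{\mathbb R^M}\exp\{-n\|\mathbf Y-f_w\|_n^2/\beta\}\,\pi(dw)}.$$ *)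

(* Defs.v *)
From HB Require Import structures.
From mathcomp Require Import all_boot all_order all_algebra.
From mathcomp Require Import all_classical all_reals all_analysis.

Set Implicit Arguments.
Unset Strict Implicit.
Unset Printing Implicit Defensive.

Import Order.TTheory GRing.Theory Num.Theory.
Import numFieldNormedType.Exports.

Local Open Scope classical_set_scope.
Local Open Scope ring_scope.

Section lebesgue_tuple.
Context {R : realType}.

Definition consT n (p : R * n.-tuple R) : n.+1.-tuple R :=
  [the n.+1.-tuple R of p.1 :: p.2].

Lemma measurable_consT n : measurable_fun [set: R * n.-tuple R] (@consT n).
Proof. exact: measurable_cons. Qed.

Definition lebesgue_consT n (m : {measure set (n.-tuple R) -> \bar R}) :=
  pushforward (lebesgue_measure \x^ m)%E (@consT n).

HB.instance Definition _ n (m : {measure set (n.-tuple R) -> \bar R}) :=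
  Measure.copy (lebesgue_consT m)
    (measure_function_pushforward__canonical__measure_function_Measure
      (lebesgue_measure \x^ m)%E (@measurable_consT n)).

(* R^n is the type n.-tuple R, whose sigma-algebra is generated by the
   coordinates. Its Lebesgue measure is the n-fold product of the Lebesgue
   measure of R, transported along R * R^n -> R^n.+1. *)
Fixpoint lebesgue_tuple n : {measure set (n.-tuple R) -> \bar R} :=
  match n with
  | 0 => \d_ [tuple]
  | n'.+1 => lebesgue_consT (lebesgue_tuple n')
  end.

End lebesgue_tuple.

Section random_variables.
Context d (Omega : measurableType d) (R : realType) (P : probability Omega R).

Definition mutually_independent (I : finType) (xi : I -> {RV P >-> R}) :=
  forall (J : {set I}) (A : I -> set R), (forall i, measurable (A i)) ->
    P (\bigcap_(i in [set` J]) (xi i @^-1` A i)) =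
    (\prod_(i in J) P (xi i @^-1` A i))%E.

(* normal_prob takes the standard deviation, not the variance, as its second
   parameter. *)
Definition iid_centered_normal (I : finType) (sigma : R)
    (xi : I -> {RV P >-> R}) :=
  mutually_independent xi /\
  forall i (A : set R), measurable A ->
    distribution P (xi i) A = normal_prob 0 sigma A.

End random_variables.

Section aggregation.
Context {R : realType} {X : Type} {n M : nat}.
Implicit Types (x : 'I_n -> X) (phi : 'I_M -> X -> R) (lam : M.-tuple R).

Definition flin phi lam (z : X) : R := \sum_(j < M) tnth lam j * phi j z.

Definition sparsity lam : nat := #|[set j : 'I_M | tnth lam j != 0]|.

Definition l1norm lam : R := \sum_(j < M) `|tnth lam j|.

(* ||v||_n^2 for a vector v of R^n; a function g on X is identified with the
   vector of its values at the design points, g \o x. *)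
Definition sqnorm_n (v : 'I_n -> R) : R := n%:R^-1 * \sum_(i < n) v i ^+ 2.

Definition q0 (t : R) : R := 3 / (2 * (1 + `|t|) ^+ 4).

Definition sparsity_density (tau : R) lam : R :=
  \prod_(j < M) (tau^-1 * q0 (tnth lam j / tau)).

Definition gibbs_weight x phi (beta : R) (y : 'I_n -> R) lam : R :=
  expR (- (n%:R * sqnorm_n (fun i => y i - flin phi lam (x i))) / beta).

Definition theta x phi (beta : R) (prior : {measure set (M.-tuple R) -> \bar R})
    (y : 'I_n -> R) lam : R :=
  gibbs_weight x phi beta y lam / \int[prior]_w gibbs_weight x phi beta y w.

Definition ewa x phi (beta : R) (prior : {measure set (M.-tuple R) -> \bar R})
    (y : 'I_n -> R) (z : X) : R :=
  \int[prior]_lam (theta x phi beta prior y lam * flin phi lam z).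

End aggregation.

(* log_+ 0 = 0, since ln vanishes on nonpositive arguments. *)
Definition logp {R : realType} (u : R) : R := Num.max (ln u) 0.

(* Main.v *)
(* Let h_i(lam) = f_lam(x_i) - f(x_i); the error of the aggregate at x_i is the
   posterior mean g_i of h_i, and we write V_i for the posterior variance of h_i
   and Z for the normalising constant of the posterior.

   PAC-Bayes: the prior dominates exp(-K) times its translate by lamstar, with
   K = 4 sum_j ln (1 + |lamstar_j| / tau). The translate has mean lamstar and
   covariance tau^2 times the identity, so Jensen's inequality yields
   - beta ln Z <= C + |xi|^2 with C = beta K + sigma^2. Since the posterior
   energy is at most - beta ln Z, sum_i (g_i^2 + V_i - 2 xi_i g_i) <= C.

   Stein: as a function of the noise xi_i, g_i has derivative 2 V_i / beta, so
   Gaussian integration by parts gives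
   2 E[xi_i g_i] = (4 sigma^2 / beta) E[V_i] <= E[V_i].

   Together, E[sum_i g_i^2] <= C, and concavity of ln bounds K. *)

(* Integrating by parts over the whole line would require decay of [g_i] times the Gaussian density
   and integrability of [V_i]. It is done instead on segments [[-a, a]], where the boundary term
   [2 sigma^2 (g_i(a) - g_i(-a)) p(a)], with [p] the Gaussian density, has a sign. The limit in [a]
   is then taken by dominated convergence, and the majorant, quadratic in the noise, comes from the
   same energy bound that drives the PAC-Bayes step.

   Along one noise coordinate [t], the other coordinates contribute to the Gibbs weight a factor
   with values in [0, 1], while [exp(-(t - h)^2 / beta)] keeps the powers of [h] bounded. Posterior
   moments are therefore finite and differentiable in [t] whatever the moments of [h] under the
   prior, which matters because [q0] decays only like [t^-4].

   The 4 in [K] is this decay exponent. Since [q0] has variance 1, the variances of the [h_i] under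
   the translated prior add up to [tau^2 sum_ij phi_j(x_i)^2 <= tau^2 n M phi0 = sigma^2]; this
   explains the choice of [tau] and the term [sigma^2] in [C]. *)
From HB Require Import structures.
Require Import Defs.
From mathcomp Require Import all_boot all_order all_algebra.
From mathcomp Require Import all_classical all_reals all_analysis.
From mathcomp Require Import measurable_realfun ring lra.

Set Implicit Arguments.
Unset Strict Implicit.
Unset Printing Implicit Defensive.

Import Order.TTheory GRing.Theory Num.Theory.
Import numFieldNormedType.Exports.

Local Open Scope classical_set_scope.
Local Open Scope ring_scope.

(** * Measures with a density *)

Section density.
Local Open Scope ereal_scope.
Context d (T : measurableType d) (R : realType).
Variables (mu nu : {measure set T -> \bar R}) (g : T -> R).
Hypothesis g_ge0 : forall x, (0 <= g x)%R.
Hypothesis mg : measurable_fun [set: T] g.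
Hypothesis nuE : forall A, measurable A -> nu A = \int[mu]_(x in A) (g x)%:E.

Import HBNNSimple.

Let integral_density_nnsfun (h : {nnsfun T >-> R}) :
  \int[nu]_x (h x)%:E = \int[mu]_x ((h x)%:E * (g x)%:E).
Proof.
have mhg r : measurable_fun [set: T]
    ((fun x => r%:E * ((\1_(h @^-1` [set r]) x)%:E * (g x)%:E)) : T -> \bar R).
  by apply: measurable_funeM; apply: emeasurable_funM; exact/measurable_EFinP.
under eq_integral do rewrite fimfunE -fsumEFin//.
rewrite ge0_integral_fsum//; last 2 first.
- move=> r; exact/measurable_EFinP/measurable_funM.
- by move=> r x _; rewrite nnfun_muleindic_ge0.
transitivity (\int[mu]_x (\sum_(r \in range h)
    (r%:E * ((\1_(h @^-1` [set r]) x)%:E * (g x)%:E)))).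
  rewrite ge0_integral_fsum//; last first.
    by move=> r x _; rewrite muleA mule_ge0 ?nnfun_muleindic_ge0 ?lee_fin.
  apply: eq_fsbigr => r /[!inE] -[x _ <-].
  rewrite integralZl_indic_nnsfun// integral_indic// setIT nuE//.
  rewrite ge0_integralZl_EFin//; last 2 first.
  - by move=> y _; rewrite -EFinM lee_fin mulr_ge0.
  - by apply: emeasurable_funM; exact/measurable_EFinP.
  congr (_ * _); rewrite integral_mkcond; apply: eq_integral => y _.
  by rewrite epatch_indic muleC.
apply: eq_integral => x _; rewrite fimfunE -fsumEFin//.
rewrite ge0_mule_fsuml; last by move=> r; exact: nnfun_muleindic_ge0.
by apply: eq_fsbigr => r _; rewrite muleA.
Qed.

(** Simple functions first, then monotone convergence. It serves both the prior, given only by its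
    values on sets, and [normal_prob]. *)
Lemma ge0_integral_density (f : T -> \bar R) :
  measurable_fun [set: T] f -> (forall x, 0 <= f x) ->
  \int[nu]_x f x = \int[mu]_x (f x * (g x)%:E).
Proof.
move=> mf f0; pose h := nnsfun_approx measurableT mf.
have cvgh x : EFin \o h^~ x @ \oo --> f x by exact: cvg_nnsfun_approx.
transitivity (limn (fun n => \int[nu]_x (h n x)%:E)).
  rewrite -monotone_convergence//=.
  - by apply: eq_integral => x _; apply/esym/cvg_lim => //; exact: cvgh.
  - by move=> n; exact/measurable_EFinP.
  - by move=> n x _; rewrite lee_fin.
  - by move=> x _ a b ab; rewrite lee_fin; exact/lefP/nd_nnsfun_approx.
under eq_fun do rewrite integral_density_nnsfun.
rewrite -monotone_convergence//=.
- apply: eq_integral => x _; apply/cvg_lim => //.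
  by apply: cvgeZr => //; exact: cvgh.
- by move=> n; apply: emeasurable_funM; exact/measurable_EFinP.
- by move=> n x _; rewrite -EFinM lee_fin mulr_ge0.
- move=> x _ a b ab; rewrite -!EFinM lee_fin ler_wpM2r//.
  exact/lefP/nd_nnsfun_approx.
Qed.

Lemma integral_density (f : T -> \bar R) : measurable_fun [set: T] f ->
  \int[nu]_x f x = \int[mu]_x (f x * (g x)%:E).
Proof.
move=> mf; rewrite integralE [RHS]integralE; congr (_ - _).
- rewrite ge0_integral_density//; last exact: measurable_funepos.
  apply: eq_integral => x _.
  (* Multiplying by [g x >= 0] commutes with taking the positive part. *)
  by rewrite !funeposE -[in RHS](mul0e (g x)%:E) maxe_pMl// lee_fin.
- rewrite ge0_integral_density//; last exact: measurable_funeneg.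
  apply: eq_integral => x _.
  by rewrite !funenegE -mulNe -[in RHS](mul0e (g x)%:E) maxe_pMl// lee_fin.
Qed.

End density.

(** * Lebesgue measure on tuples *)

Section lebesgue_tuple_theory.
Local Open Scope ereal_scope.
Context {R : realType}.
Local Notation L := (@lebesgue_measure R).

Let box n (k : nat) : set (n.-tuple R) :=
  [set z | forall i, `|tnth z i| <= k%:R]%R.

Let measurable_box n k : measurable (@box n k).
Proof.
rewrite (_ : box _ = \bigcap_(i in [set: 'I_n])
    ((@tnth n R)^~ i @^-1` `[(- k%:R)%R, k%:R]%classic)); last first.
  apply/seteqP; split => [z zk i _|z zk i] /=.
    by rewrite in_itv/= -ler_norml.
  by have := zk i I; rewrite /= in_itv/= -ler_norml.
apply: fin_bigcap_measurable => // i _; rewrite -[X in measurable X]setTI.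
exact: measurable_tnth.
Qed.

Lemma lebesgue_tuple_sigma_finite n :
  sigma_finite [set: n.-tuple R] (lebesgue_tuple n).
Proof.
exists (@box n) => [|k].
  apply/seteqP; split => // z _.
  exists (Num.truncn (\sum_i `|tnth z i|)).+1 => //= i.
  apply: (@le_trans _ _ (\sum_i `|tnth z i|)%R); last exact/ltW/truncnS_gt.
  by rewrite (bigD1 i)//= lerDl sumr_ge0.
split; first exact: measurable_box.
elim: n => [|n ih]; first by rewrite /= diracE ltry.
rewrite /= /lebesgue_consT /pushforward.
rewrite (_ : _ @^-1` _ = `[(- k%:R)%R, k%:R]%classic `*` @box n k); last first.
  apply/seteqP; split => [[t z] tz|[t z] [/= tk zk] i] /=.
    split => /=; first by have := tz ord0; rewrite in_itv/= -ler_norml.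
    by move=> i; have := tz (lift ord0 i); rewrite tnthS.
  move: tk; rewrite in_itv/= -ler_norml.
  by case: (unliftP ord0 i) => [j ->|->//]; rewrite tnthS.
rewrite product_measure2E//; last exact: measurable_box.
rewrite lte_mul_pinfty//; have := @lebesgue_measure_itv R `[(- k%:R)%R, k%:R].
by rewrite /= => ->; case: ifP.
Qed.

(* The values of a Fixpoint cannot carry a canonical sigma-finite structure. *)
Definition sf_lebesgue_tuple n : set (n.-tuple R) -> \bar R :=
  lebesgue_tuple n.

HB.instance Definition _ n :=
  Measure.copy (@sf_lebesgue_tuple n) (lebesgue_tuple n).

HB.instance Definition _ n := Measure_isSigmaFinite.Build _ _ _
  (@sf_lebesgue_tuple n) (@lebesgue_tuple_sigma_finite n).

Lemma ge0_integral_lebesgue_tupleS n (f : n.+1.-tuple R -> \bar R) :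
  measurable_fun [set: n.+1.-tuple R] f -> (forall z, 0 <= f z) ->
  \int[lebesgue_tuple n.+1]_z f z =
  \int[lebesgue_tuple n]_z \int[L]_t f (consT (t, z)).
Proof.
move=> mf f0.
rewrite /= [LHS]ge0_integral_pushforward//; last exact: measurable_consT.
rewrite -[RHS](@fubini_tonelli2 _ _ _ _ R L (@sf_lebesgue_tuple n)
  (f \o @consT R n))//.
(* [\x^], used to define the measure, and [\x], used by Tonelli, are distinct constructions of the
   product; they agree on rectangles, hence everywhere. *)
- apply: eq_measure_integral => A mA _ /=.
  symmetry.
  apply: (@product_measure_unique _ _ _ _ R L (@sf_lebesgue_tuple n)) => // B C mB mC.
  exact: (product_measure2E _ (lebesgue_tuple n) mB mC).
- by apply: measurableT_comp => //; exact: measurable_consT.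
- by move=> z; exact: f0.
Qed.

Lemma lebesgue_measure_shift (a : R) (A : set R) : measurable A ->
  pushforward L ((fun t => t + a)%R : measurableTypeR R -> measurableTypeR R) A
  = L A.
Proof.
move=> mA; apply/esym.
have ms : measurable_fun setT
    ((fun t => t + a)%R : measurableTypeR R -> measurableTypeR R).
  exact: measurable_funD.
apply: (@lebesgue_measure_unique R
  (measure_function_pushforward__canonical__measure_function_Measure L ms))
  => // _ [[b c]] _ <-.
rewrite /= /pushforward.
rewrite (_ : _ @^-1` _ = `](b - a)%R, (c - a)%R]%classic); last first.
  by apply/seteqP; split => t /=; rewrite !in_itv/= ltrBlDr lerBrDr.
by rewrite !lebesgue_measure_itv/= !lte_fin ltrD2r -!EFinB opprB addrA subrK.
Qed.

Lemma ge0_integral_lebesgue_measure_shift (a : R) (g : R -> \bar R) :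
  measurable_fun [set: R] g -> (forall t, 0 <= g t) ->
  \int[L]_t g (t + a)%R = \int[L]_t g t.
Proof.
move=> mg g0.
have ms : measurable_fun setT
    ((fun t => t + a)%R : measurableTypeR R -> measurableTypeR R).
  exact: measurable_funD.
have -> : \int[L]_t g t = \int[pushforward L
    ((fun t => t + a)%R : measurableTypeR R -> measurableTypeR R)]_t g t.
  apply: eq_measure_integral => A mA _.
  by apply/esym; exact: (lebesgue_measure_shift a mA).
by rewrite (ge0_integral_pushforward ms).
Qed.

Definition tuple_shift n (a z : n.-tuple R) : n.-tuple R :=
  [tuple tnth z i + tnth a i | i < n]%R.

Lemma measurable_tuple_shift n (a : n.-tuple R) :
  measurable_fun [set: n.-tuple R] (tuple_shift a).
Proof.
apply/measurable_fun_tnthP => i.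
rewrite (_ : _ \o _ = fun z => (tnth z i + tnth a i)%R); last first.
  by apply/funext => z /=; rewrite tnth_mktuple.
by apply: measurable_funD => //; exact: measurable_tnth.
Qed.

(** The first coordinate moves by invariance on the line. The induction hypothesis moves the others,
    applied to [f] already integrated in its first argument, which is why [f] is generalized. *)
Lemma ge0_integral_lebesgue_tuple_shift n (a : n.-tuple R)
    (f : n.-tuple R -> \bar R) :
  measurable_fun [set: n.-tuple R] f -> (forall z, 0 <= f z) ->
  \int[lebesgue_tuple n]_z f (tuple_shift a z) = \int[lebesgue_tuple n]_z f z.
Proof.
elim: n => [|n ih] in a f * => mf f0.
  by apply: eq_integral => z _; rewrite [tuple_shift _ _]tuple0 [z]tuple0.
have mfs : measurable_fun [set: n.+1.-tuple R] (f \o tuple_shift a).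
  exact: (measurableT_comp mf (@measurable_tuple_shift _ a)).
rewrite (ge0_integral_lebesgue_tupleS mfs); last by move=> z; exact: f0.
rewrite (ge0_integral_lebesgue_tupleS mf)//.
pose a' : n.-tuple R := [tuple of behead a].
have shE t z : tuple_shift a (consT (t, z)) =
    consT ((t + thead a)%R, tuple_shift a' z).
  apply: eq_from_tnth => i; rewrite tnth_mktuple.
  case: (unliftP ord0 i) => [j ->|->].
    by rewrite !tnthS tnth_mktuple [a in LHS](tuple_eta a) tnthS.
  by rewrite !tnth0.
have mfc : measurable_fun [set: R * n.-tuple R] (f \o @consT R n).
  exact: (measurableT_comp mf (@measurable_consT R n)).
rewrite -[RHS](ih a'); last 2 first.
- exact: (measurable_fun_fubini_tonelli_G (m1 := L) _ mfc
    (fun tz => f0 (consT tz))).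
- by move=> z; exact: integral_ge0.
apply: eq_integral => z _.
transitivity (\int[L]_t f (consT ((t + thead a)%R, tuple_shift a' z))).
  by apply: eq_integral => t _; congr (f _); exact: shE.
set g := fun t => f (consT (t, tuple_shift a' z)).
have mg : measurable_fun [set: R] g.
  apply: (measurableT_comp mfc (g := fun t : R => (t, tuple_shift a' z))).
  exact: measurable_fun_pair.
by have := ge0_integral_lebesgue_measure_shift (thead a) mg (fun t => f0 _).
Qed.

End lebesgue_tuple_theory.

(** * The sparsity prior *)

Section prior_moments.
Context {R : realType}.
Variables (tau : R) (tau_gt0 : 0 < tau).
Local Notation L := (@lebesgue_measure R).

Let q (t : R) : R := tau^-1 * q0 (t / tau).

Lemma q0_gt0 (t : R) : 0 < q0 t.
Proof. by rewrite divr_gt0// mulr_gt0// exprn_gt0// ltr_pwDl. Qed.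

Lemma continuous_scaled_q0 : continuous q.
Proof.
move=> t; apply: cvgM; first exact: cvg_cst.
apply: cvgM; first exact: cvg_cst.
apply: cvgV; first by rewrite gt_eqF// mulr_gt0// exprn_gt0// ltr_pwDl.
apply: cvgM; first exact: cvg_cst.
apply: (@continuous_comp _ _ _ (fun s : R => 1 + `|s / tau|) (fun s => s ^+ 4)).
  apply: cvgD; first exact: cvg_cst.
  apply: (@continuous_comp _ _ _ (fun s : R => s / tau) (fun s : R => `|s|)).
    exact: mulrr_continuous.
  exact: norm_continuous.
exact: exprn_continuous.
Qed.

Let q_ge0 t : 0 <= q t.
Proof. by rewrite mulr_ge0 ?invr_ge0 ?ltW// q0_gt0. Qed.

Let qN t : q (- t) = q t.
Proof. by rewrite /q /q0 mulNr normrN. Qed.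

Let qE (t : R) : 0 <= t -> q t = 3 * tau ^+ 3 / (2 * (tau + t) ^+ 4).
Proof.
move=> t0; have tt0 : tau + t != 0 by rewrite gt_eqF// ltr_pwDl.
rewrite /q /q0 ger0_norm ?divr_ge0 ?(ltW tau_gt0)//.
field.
by rewrite tt0 gt_eqF.
Qed.

(** With [y = 1 / (tau + t)] one has [dy/dt = - y^2] and [t^2 y^4 = y^2 - 2 tau y^3 + tau^2 y^4], so
    the integrand has an antiderivative [H] polynomial in [y] and vanishing at [y = 0], that is, at
    infinity. The factor 2 accounts for the two half-lines. *)
Let half_moment (a c : R) : 0 <= a -> 0 <= c ->
  (\int[L]_(t in `[0%R, +oo[) (2 * ((a + c * t ^+ 2) * q t))%:E =
    (a + c * tau ^+ 2)%:E)%E.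
Proof.
move=> a0 c0.
pose v t : R := (tau + t)^-1.
pose H (y : R) : R := - (tau ^+ 3 * a) * y ^+ 3 +
  (3 * c * tau ^+ 3) * (- y + tau * y ^+ 2 - (tau ^+ 2 / 3) * y ^+ 3).
pose F (t : R) : R := H (v t).
have cH : continuous H.
  move=> y; apply: cvgD.
    by apply: cvgM; [exact: cvg_cst|exact: exprn_continuous].
  apply: cvgM; first exact: cvg_cst.
  apply: cvgB.
    apply: cvgD; first by apply: (@cvgN _ R^o); exact: cvg_id.
    by apply: cvgM; [exact: cvg_cst|exact: exprn_continuous].
  by apply: cvgM; [exact: cvg_cst|exact: exprn_continuous].
have dF (t : R) : 0 <= t -> is_derive t 1 F (2 * ((a + c * t ^+ 2) * q t)).
  move=> t0; have tt0 : tau + t != 0 by rewrite gt_eqF// ltr_pwDl.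
  rewrite /F /H /v; apply: is_derive_eq.
  rewrite qE// /GRing.scale/= /GRing.scale/=; field.
  by rewrite tt0.
have -> : a + c * tau ^+ 2 = 0 - F 0.
  rewrite /F /H /v addr0; field.
  by rewrite gt_eqF.
have cg : continuous (fun t : R => 2 * ((a + c * t ^+ 2) * q t)).
  move=> t; apply: cvgM; first exact: cvg_cst.
  apply: cvgM; last exact: continuous_scaled_q0.
  apply: cvgD; first exact: cvg_cst.
  by apply: cvgM; [exact: cvg_cst|exact: exprn_continuous].
apply: ge0_continuous_FTC2y.
- by move=> t t0; rewrite mulr_ge0// mulr_ge0// addr_ge0// mulr_ge0// sqr_ge0.
- exact: continuous_subspaceT.
- have -> : 0 = H 0 by rewrite /H; ring.
  apply: continuous_cvg; first exact: cH.
  apply/gtr0_cvgV0; last exact: cvg_addrl.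
  by near=> t; rewrite ltr_pwDl//; near: t; exact: nbhs_pinfty_ge.
- by move=> t /ltW t0; have [] := dF t t0.
- apply: cvg_at_right_filter; apply: differentiable_continuous.
  by apply/derivable1_diffP; have [] := dF 0 (lexx _).
- move=> t; rewrite in_itv/= andbT => /ltW t0.
  by rewrite derive1E; apply: derive_val; exact: dF.
Unshelve. all: by end_near. Qed.

(** Folding the line onto [[0, +oo[] cancels the cross term [- 2 a c t], because the density is
    even. *)
Lemma scaled_q0_second_moment (a c : R) :
  (\int[L]_t ((a - c * t) ^+ 2 * q t)%:E = (a ^+ 2 + c ^+ 2 * tau ^+ 2)%:E)%E.
Proof.
set f := fun t : R => ((a - c * t) ^+ 2 * q t).
have cf : continuous f.
  move=> t; apply: cvgM; last exact: continuous_scaled_q0.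
  apply: (@continuous_comp _ _ _ (fun s : R => a - c * s) (fun s => s ^+ 2)).
    apply: cvgB; first exact: cvg_cst.
    exact: mulrl_continuous.
  exact: exprn_continuous.
have f0 t : 0 <= f t by rewrite mulr_ge0// sqr_ge0.
have mf : measurable_fun [set: R] f by exact: continuous_measurable_fun.
have mfN : measurable_fun [set: R] (fun t => f (- t)).
  exact: (measurableT_comp mf (measurable_funN (@measurable_id _ R setT))).
rewrite -(setUv (`[0%R, +oo[%classic : set R)) ge0_integral_setU//=; last 4 first.
- exact: measurableC.
- by apply/measurable_EFinP; rewrite setUv.
- by move=> x _; rewrite lee_fin; exact: f0.
- exact/disj_setPCl.
rewrite setCitvr integral_itv_bndo_bndc; last first.
  exact/measurable_EFinP/measurable_funTS.
have -> : (\int[L]_(t in `]-oo, 0%R]) (f t)%:E =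
    \int[L]_(t in `[0%R, +oo[) (f (- t))%:E)%E.
  rewrite (@ge0_integration_by_substitution0 R (fun t => (f (- t))%:E)).
  - by apply: eq_integral => t _; rewrite opprK.
  - exact/measurable_EFinP.
  - by move=> t; rewrite lee_fin; exact: f0.
rewrite -ge0_integralD//=; last 4 first.
- by move=> t _; rewrite lee_fin; exact: f0.
- exact/measurable_EFinP/measurable_funTS.
- by move=> t _; rewrite lee_fin; exact: f0.
- exact/measurable_EFinP/measurable_funTS.
rewrite -(half_moment (sqr_ge0 a) (sqr_ge0 c)).
apply: eq_integral => t _; rewrite -EFinD /f qN; congr EFin; ring.
Qed.

End prior_moments.

Section sparsity_prior.
Context {R : realType}.
Variables (tau : R) (tau_gt0 : 0 < tau).

Lemma sparsity_density_consT n (t : R) (z : n.-tuple R) :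
  sparsity_density tau (consT (t, z)) =
  tau^-1 * q0 (t / tau) * sparsity_density tau z.
Proof.
rewrite /sparsity_density big_ord_recl tnth0; congr (_ * _).
by apply: eq_bigr => i _; rewrite tnthS.
Qed.

Lemma sparsity_density_ge0 n (z : n.-tuple R) : 0 <= sparsity_density tau z.
Proof.
apply: prodr_ge0 => i _; rewrite mulr_ge0 ?invr_ge0 ?(ltW tau_gt0)//.
exact/ltW/q0_gt0.
Qed.

Lemma measurable_sparsity_density n :
  measurable_fun [set: n.-tuple R] (sparsity_density tau).
Proof.
apply: measurable_prod => i _.
apply: (@measurableT_comp _ _ _ _ _ _
  (fun t : R => tau^-1 * q0 (t / tau))); last exact: measurable_tnth.
by apply: continuous_measurable_fun; exact: continuous_scaled_q0.
Qed.

Lemma sparsity_density_second_moment n (a : R) (c : 'I_n -> R) :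
  (\int[lebesgue_tuple n]_z
     ((a - \sum_j c j * tnth z j) ^+ 2 * sparsity_density tau z)%:E =
   (a ^+ 2 + tau ^+ 2 * \sum_j c j ^+ 2)%:E)%E.
Proof.
have mF m b (e : 'I_m -> R) : measurable_fun [set: m.-tuple R]
    (fun z => ((b - \sum_j e j * tnth z j) ^+ 2 * sparsity_density tau z)%:E).
  apply/measurable_EFinP/measurable_funM; last exact: measurable_sparsity_density.
  apply: measurable_funX; apply: measurable_funB => //.
  apply: measurable_sum => i; apply: measurable_funM => //.
  exact: measurable_tnth.
have F0 m b (e : 'I_m -> R) (z : m.-tuple R) :
    (0 <= ((b - \sum_j e j * tnth z j) ^+ 2 * sparsity_density tau z)%:E)%E.
  by rewrite lee_fin mulr_ge0 ?sqr_ge0 ?sparsity_density_ge0.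
elim: n => [|n ih] in a c *.
  rewrite /= integral_dirac//; last exact: mF.
  rewrite [X in (X * _)%E](_ : _ = 1%E); last exact: diracT.
  rewrite mul1e /sparsity_density !big_ord0.
  by rewrite subr0 mulr1 mulr0 addr0.
rewrite ge0_integral_lebesgue_tupleS//.
pose S (z : n.-tuple R) := \sum_j c (lift ord0 j) * tnth z j.
(* The variance of the first coordinate multiplies the total mass of the others. That mass is
   written as the case [a = 1], [c = 0] of the statement, so that the induction hypothesis evaluates
   both terms. *)
transitivity (\int[lebesgue_tuple n]_z
   (((a - S z) ^+ 2 * sparsity_density tau z)%:E +
    (c ord0 ^+ 2 * tau ^+ 2)%:E *
      ((1 - \sum_(j < n) 0 * tnth z j) ^+ 2 * sparsity_density tau z)%:E))%E.
  apply: eq_integral => z _.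
  transitivity (\int[lebesgue_measure]_t
    ((sparsity_density tau z)%:E *
     (((a - S z) - c ord0 * t) ^+ 2 * (tau^-1 * q0 (t / tau)))%:E))%E.
    apply: eq_integral => t _.
    rewrite sparsity_density_consT big_ord_recl tnth0.
    under eq_bigr do rewrite tnthS.
    rewrite -/(S z) -EFinM; congr EFin; rewrite [(t, z).1]/=; ring.
  rewrite ge0_integralZl//; last 3 first.
  - apply/measurable_EFinP/measurable_funM; last first.
      by apply: continuous_measurable_fun; exact: continuous_scaled_q0.
    by apply: measurable_funX; apply: measurable_funB => //; exact: measurable_funM.
  - move=> t _; rewrite lee_fin mulr_ge0 ?sqr_ge0// mulr_ge0 ?invr_ge0 ?(ltW tau_gt0)//.
    exact/ltW/q0_gt0.
  - by rewrite lee_fin sparsity_density_ge0.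
  rewrite scaled_q0_second_moment// -!EFinM -EFinD; congr EFin.
  rewrite big1; last by move=> j _; rewrite mul0r.
  by ring.
rewrite ge0_integralD//=; last 2 first.
- move=> z _; apply: mule_ge0; last exact: F0.
  by rewrite lee_fin mulr_ge0 ?sqr_ge0.
- by apply: measurable_funeM; exact: mF.
rewrite ge0_integralZl//; last by rewrite lee_fin mulr_ge0 ?sqr_ge0.
rewrite !ih -EFinM -EFinD; congr EFin; rewrite big_ord_recl.
rewrite [X in (1 ^+ 2 + _ * X)]big1; last by move=> j _; rewrite expr0n.
  by ring.
- exact: mF.
- by move=> z _; exact: F0.
- by move=> z _; exact: F0.
- exact: mF.
Qed.

Definition shift_cost n (a : n.-tuple R) : R :=
  4 * \sum_(j < n) ln (1 + `|tnth a j| / tau).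

(** In each coordinate [1 + |y + b| / tau <= (1 + |b| / tau) (1 + |y| / tau)]; the fourth power in
    [q0] turns this into the factor 4 of [shift_cost]. *)
Lemma sparsity_density_shift_ge n (a z : n.-tuple R) :
  expR (- shift_cost a) * sparsity_density tau z <=
  sparsity_density tau (tuple_shift a z).
Proof.
rewrite /shift_cost mulr_sumr -sumrN expR_sum -big_split/=.
apply: ler_prod => i _; rewrite tnth_mktuple; apply/andP; split.
  rewrite mulr_ge0 ?expR_ge0// mulr_ge0 ?invr_ge0 ?(ltW tau_gt0)//.
  exact/ltW/q0_gt0.
set b := tnth a i; set y := tnth z i.
have b0 : 0 < 1 + `|b| / tau by rewrite ltr_pwDl// divr_ge0// ltW.
have -> : expR (- (4 * ln (1 + `|b| / tau))) = (1 + `|b| / tau) ^- 4.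
  by rewrite expRN expRM_natl lnK.
rewrite mulrCA ler_wpM2l ?invr_ge0 ?(ltW tau_gt0)//.
have y0 (s : R) : 0 < 1 + `|s / tau| by rewrite ltr_pwDl.
rewrite /q0 mulrCA ler_wpM2l//.
rewrite -invfM lef_pV2 ?posrE ?mulr_gt0 ?exprn_gt0//.
rewrite [leRHS]mulrCA ler_wpM2l// -exprMn.
have bE : `|b| / tau = `|b / tau| by rewrite normrM normfV (gtr0_norm tau_gt0).
rewrite lerXn2r// ?nnegrE; [exact/ltW|exact/ltW/mulr_gt0|rewrite bE mulrDl].
have := ler_normD (y / tau) (b / tau).
by have := mulr_ge0 (normr_ge0 (b / tau)) (normr_ge0 (y / tau)); lra.
Qed.

Variables (n : nat) (prior : {measure set (n.-tuple R) -> \bar R}).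
Hypothesis priorE : forall A : set (n.-tuple R), measurable A ->
  prior A = (\int[lebesgue_tuple n]_(lam in A)
               (sparsity_density tau lam)%:E)%E.

Lemma sparsity_prior_second_moment (a : R) (c : 'I_n -> R) :
  (\int[prior]_z ((a - \sum_j c j * tnth z j) ^+ 2)%:E =
   (a ^+ 2 + tau ^+ 2 * \sum_j c j ^+ 2)%:E)%E.
Proof.
rewrite -sparsity_density_second_moment.
rewrite (ge0_integral_density (@sparsity_density_ge0 n)
  (@measurable_sparsity_density n) priorE)//.
  apply/measurable_EFinP; apply: measurable_funX; apply: measurable_funB => //.
  apply: measurable_sum => i; apply: measurable_funM => //.
  exact: measurable_tnth.
by move=> z; rewrite lee_fin sqr_ge0.
Qed.

Lemma sparsity_prior_setT : prior [set: n.-tuple R] = 1%E.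
Proof.
have := sparsity_prior_second_moment 1 (fun=> 0).
rewrite [in RHS]big1 ?mulr0 ?addr0 ?expr1n => [<-|j _]; last by rewrite expr0n.
rewrite -[LHS]mul1e -integral_cst//; apply: eq_integral => z _.
by rewrite big1 ?subr0 ?expr1n// => j _; rewrite mul0r.
Qed.

(** Invariance of Lebesgue measure rewrites the right side as the integral of [f(z + a) q(z + a)],
    with [q] the prior density, and the densities are then compared pointwise. *)
Lemma sparsity_prior_shift_le (a : n.-tuple R) (f : n.-tuple R -> \bar R) :
  measurable_fun [set: n.-tuple R] f -> (forall z, 0 <= f z)%E ->
  ((expR (- shift_cost a))%:E * \int[prior]_z f (tuple_shift a z) <=
   \int[prior]_z f z)%E.
Proof.
move=> mf f0.
have mfs : measurable_fun [set: n.-tuple R] (f \o tuple_shift a).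
  exact: (measurableT_comp mf (@measurable_tuple_shift R n a)).
have mq := @measurable_sparsity_density n.
have mqs : measurable_fun [set: n.-tuple R] (sparsity_density tau \o tuple_shift a).
  exact: (measurableT_comp mq (@measurable_tuple_shift R n a)).
have E := ge0_integral_density (@sparsity_density_ge0 n) mq priorE.
rewrite (E _ mf f0) (E _ mfs (fun z => f0 _)).
have dens0 (z : n.-tuple R) : (0 <= (sparsity_density tau z)%:E)%E.
  by rewrite lee_fin sparsity_density_ge0.
have mqE : measurable_fun [set: n.-tuple R] (EFin \o sparsity_density tau).
  exact/measurable_EFinP.
have mqsE : measurable_fun [set: n.-tuple R]
    (EFin \o (sparsity_density tau \o tuple_shift a)).
  exact/measurable_EFinP.
have mfsq := emeasurable_funM mfs mqE.
have fsq0 z : (0 <= f (tuple_shift a z) * (sparsity_density tau z)%:E)%E.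
  by rewrite mule_ge0.
rewrite -(ge0_integralZl _ measurableT mfsq) ?lee_fin ?expR_ge0//; last first.
  by move=> z _; exact: fsq0.
rewrite -[leRHS](ge0_integral_lebesgue_tuple_shift a); last 2 first.
- exact: (emeasurable_funM mf mqE).
- by move=> z; rewrite mule_ge0.
apply: ge0_le_integral => //.
- by move=> z _; apply: mule_ge0; [rewrite lee_fin expR_ge0|exact: fsq0].
- by apply: measurable_funeM; exact: mfsq.
- exact: (emeasurable_funM mfs mqsE).
move=> z _ /=; rewrite muleCA lee_wpmul2l//.
by rewrite -EFinM lee_fin sparsity_density_shift_ge.
Qed.

End sparsity_prior.

(** * Stein's inequality for tilted measures *)

Section tilted_moments.
Context {R : realType} d (T : measurableType d) (mu : {measure set T -> \bar R}).
Variables (beta : R) (h w : T -> R).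
Hypothesis mu_fin : (mu [set: T] < +oo)%E.
Hypothesis beta_gt0 : 0 < beta.
Hypothesis mh : measurable_fun [set: T] h.
Hypothesis mw : measurable_fun [set: T] w.
Hypothesis w01 : forall l, 0 <= w l <= 1.

(** The posterior seen along a single noise coordinate [t]: [w] stands for the Gibbs factor of all
    the other coordinates, which are frozen. *)
Definition tilted_integrand (k : nat) (t : R) (l : T) : R :=
  w l * h l ^+ k * expR (- (t - h l) ^+ 2 / beta).

Definition tilted_moment (k : nat) (t : R) : R :=
  \int[mu]_l tilted_integrand k t l.

Local Notation G := tilted_integrand.
Local Notation m := tilted_moment.

Lemma measurable_tilted_integrand k t : measurable_fun [set: T] (G k t).
Proof.
apply: measurable_funM.
  by apply: measurable_funM => //; exact: measurable_funX.
apply: measurableT_comp => //; apply: measurable_funM => //.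
apply: measurable_funN; apply: measurable_funX.
exact: measurable_funB.
Qed.

Lemma sqr_expRN_le (x : R) : 0 <= x -> x ^+ 2 * expR (- x) <= 2.
Proof.
move=> x0; rewrite expRN ler_pdivrMr ?expR_gt0//.
by have := expR_ge1Dxn 1 x0; rewrite (_ : 2`! = 2)%N; [lra|by []].
Qed.

(** With [u = t - h], the terms come from [|h|^k <= 1 + h^4], from [h^4 <= 8 (t^4 + u^4)] by
    convexity, and from [u^4 exp(- u^2 / beta) <= 2 beta^2]. *)
Let C (B : R) : R := 1 + 8 * B ^+ 4 + 16 * beta ^+ 2.

Let C_ge0 B : 0 <= C B.
Proof.
have B4 : 0 <= B ^+ 4 by rewrite -[4%N]/(2 * 2)%N exprM sqr_ge0.
by have := sqr_ge0 beta; rewrite /C; lra.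
Qed.

(** Being uniform in [l], the bound gives integrability against a finite measure; being uniform over
    [|t| <= B], it also dominates the derivatives in [t]. *)
Lemma tilted_integrand_bound k t (B : R) l : (k <= 4)%N -> `|t| <= B ->
  `|G k t l| <= C B.
Proof.
move=> k4 tB; have B0 : 0 <= B by exact: le_trans tB.
have /andP[w0 w1] := w01 l.
rewrite /G !normrM (ger0_norm w0) (ger0_norm (expR_ge0 _)) -mulrA.
apply: (@le_trans _ _ (`|h l ^+ k| * expR (- (t - h l) ^+ 2 / beta))).
  by rewrite ler_piMl// mulr_ge0 ?expR_ge0.
apply: (@le_trans _ _ ((1 + h l ^+ 4) * expR (- (t - h l) ^+ 2 / beta))).
  rewrite ler_wpM2r ?expR_ge0// normrX.
  have -> : h l ^+ 4 = `|h l| ^+ 4.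
    by rewrite -normrX ger0_norm// -[4%N]/(2 * 2)%N exprM sqr_ge0.
  have [h1|h1] := leP `|h l| 1.
    by rewrite (le_trans (exprn_ile1 _ _ h1))// lerDl exprn_ge0.
  apply: (@le_trans _ _ (`|h l| ^+ 4)); last by rewrite lerDr.
  by rewrite ler_weXn2l// ltW.
set u := t - h l.
have hE : h l = t - u by rewrite /u opprB addrC subrK.
have h4 : h l ^+ 4 <= 8 * (B ^+ 4 + u ^+ 4).
  apply: (@le_trans _ _ (8 * (t ^+ 4 + u ^+ 4))).
    rewrite hE; have := sqr_ge0 (t + u); have := sqr_ge0 (t ^+ 2 - u ^+ 2).
    have := sqr_ge0 ((t + u) ^+ 2); have := mulr_ge0 (sqr_ge0 (t + u)) (sqr_ge0 t).
    have := mulr_ge0 (sqr_ge0 (t + u)) (sqr_ge0 u).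
    have := mulr_ge0 (sqr_ge0 (t + u)) (sqr_ge0 (t - u)).
    have := mulr_ge0 (sqr_ge0 t) (sqr_ge0 u). nra.
  rewrite ler_wpM2l// lerD2r -(@ger0_norm _ (t ^+ 4)).
    by rewrite normrX lerXn2r// nnegrE.
  by rewrite -[4%N]/(2 * 2)%N exprM sqr_ge0.
have x0 : 0 <= u ^+ 2 / beta by rewrite divr_ge0 ?sqr_ge0 ?ltW.
have e1 : expR (- u ^+ 2 / beta) <= 1.
  by rewrite -expR0 ler_expR mulNr oppr_le0.
have e2 : u ^+ 4 * expR (- u ^+ 2 / beta) <= 2 * beta ^+ 2.
  have := sqr_expRN_le x0; rewrite -mulNr expr_div_n -exprM.
  rewrite -[(2 * 2)%N]/4%N mulrAC ler_pdivrMr//.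
  by rewrite exprn_gt0.
apply: (@le_trans _ _ ((1 + 8 * (B ^+ 4 + u ^+ 4)) * expR (- u ^+ 2 / beta))).
  by rewrite ler_wpM2r ?expR_ge0// lerD2l.
have e0 := expR_ge0 (- u ^+ 2 / beta).
have B4 : 0 <= B ^+ 4 by rewrite exprn_ge0.
rewrite /C; nra.
Qed.

Lemma integrable_tilted_integrand k t : (k <= 4)%N ->
  mu.-integrable [set: T] (EFin \o G k t).
Proof.
move=> k4; apply: measurable_bounded_integrable => //.
  exact: measurable_tilted_integrand.
exists (C `|t|); split; first by rewrite num_real.
by move=> b Cb l _; apply: le_trans (ltW Cb); exact: tilted_integrand_bound.
Qed.

(** The Gaussian factor brings down [- (2 / beta) (t - h)], so a derivative in [t] raises the order
    of the moment by one. *)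
Lemma is_derive_tilted_integrand k (t : R) l :
  is_derive t 1 (fun s : R => G k s l : R) (- (2 / beta) * (t * G k t l - G k.+1 t l)).
Proof.
rewrite /G; apply: is_derive_eq.
rewrite /GRing.scale/= [h l ^+ k.+1]exprS; set e := expR _; field.
by rewrite gt_eqF.
Qed.

(** Differentiation under the integral on []t - 1, t + 1[], dominated by a constant. The order stops
    at 3 because moment [k.+1] must still satisfy [tilted_integrand_bound]. *)
Lemma is_derive_tilted_moment k (t : R) : (k <= 3)%N ->
  is_derive t 1 (m k : R -> R) (- (2 / beta) * (t * m k t - m k.+1 t)).
Proof.
move=> k3; pose B := `|t| + 1.
have k4 : (k <= 4)%N by rewrite ltnW.
have tI : `]t - 1, t + 1[%classic t.
  by rewrite /= in_itv/= ltrBlDr !ltrDl ltr01.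
have ltB s : `]t - 1, t + 1[%classic s -> `|s| <= B.
  rewrite /= in_itv/= => /andP[s1 s2]; rewrite /B.
  have : `|s - t| <= 1 by rewrite ler_norml; apply/andP; split; lra.
  by have := ler_normD (s - t) t; rewrite subrK; lra.
have d1 s l : partial1of2 (G k) s l =
    - (2 / beta) * (s * G k s l - G k.+1 s l).
  rewrite partial1of2E; apply: derive_val.
  exact: is_derive_tilted_integrand.
pose D := 2 / beta * (B * C B + C B).
have D0 : 0 <= D.
  by rewrite mulr_ge0 ?divr_ge0 ?(ltW beta_gt0)// addr_ge0// mulr_ge0// addr_ge0.
have iD : mu.-integrable [set: T] (EFin \o cst D).
  apply: measurable_bounded_integrable => //.
  exists D; split; first by rewrite num_real.
  by move=> b Db l _ /=; rewrite ger0_norm// ltW.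
have Dub s l : `]t - 1, t + 1[%classic s -> [set: T] l ->
    `|partial1of2 (G k) s l| <= cst D l.
  move=> /ltB sB _; rewrite d1 normrM normrN (@ger0_norm _ (2 / beta));
    last by rewrite divr_ge0 ?(ltW beta_gt0).
  rewrite /cst /D ler_wpM2l ?divr_ge0 ?(ltW beta_gt0)//.
  rewrite (le_trans (ler_normB _ _))// lerD ?tilted_integrand_bound//.
  by rewrite normrM ler_pM// tilted_integrand_bound.
have int s : `]t - 1, t + 1[%classic s -> mu.-integrable [set: T] (EFin \o G k s).
  by move=> _; exact: integrable_tilted_integrand.
have der s l : `]t - 1, t + 1[%classic s -> [set: T] l ->
    derivable (G k ^~ l) s 1.
  by move=> _ _; have [] := is_derive_tilted_integrand k s l.
split.
  exact: (derivable_under_integral measurableT tI int der (fun=> D0) iD Dub).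
rewrite -derive1E.
rewrite (differentiation_under_integral measurableT tI int der (fun=> D0) iD Dub).
under eq_Rintegral do rewrite d1.
have i1 := integrable_tilted_integrand t k4.
have i2 := @integrable_tilted_integrand k.+1 t k3.
have i3 : mu.-integrable [set: T] (EFin \o (fun l => t * G k t l)).
  exact: (integrableZl measurableT t i1).
rewrite RintegralZl//; last exact: (integrableB measurableT i3 i2).
by rewrite RintegralB// RintegralZl.
Qed.

End tilted_moments.

Section tilted_stein.
Context {R : realType} d (T : measurableType d) (mu : {measure set T -> \bar R}).
Variables (beta : R) (h w : T -> R).
Hypothesis mu_fin : (mu [set: T] < +oo)%E.
Hypothesis beta_gt0 : 0 < beta.
Hypothesis mh : measurable_fun [set: T] h.
Hypothesis mw : measurable_fun [set: T] w.
Hypothesis w01 : forall l, 0 <= w l <= 1.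

Local Notation m := (tilted_moment mu beta h w).
Local Notation L := (@lebesgue_measure R).

Hypothesis m0_gt0 : forall t, 0 < m 0 t.

Definition tilted_mean (t : R) : R := m 1 t / m 0 t.

Definition tilted_var (t : R) : R := m 2 t / m 0 t - tilted_mean t ^+ 2.

Let dm k (t : R) : (k <= 3)%N ->
  is_derive t 1 (m k : R -> R) (- (2 / beta) * (t * m k t - m k.+1 t)).
Proof. exact: is_derive_tilted_moment. Qed.

Let continuous_m k : (k <= 3)%N -> continuous (m k : R -> R).
Proof.
move=> k3 t; apply: differentiable_continuous; apply/derivable1_diffP.
by have [] := dm t k3.
Qed.

(** In the quotient rule the two terms carrying the factor [t] cancel, and what remains is a
    variance. *)
Lemma is_derive_tilted_mean (t : R) :
  is_derive t 1 (tilted_mean : R -> R) (2 / beta * tilted_var t).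
Proof.
have m00 : m 0 t != 0 by rewrite gt_eqF.
have d0 := @dm 0%N t isT; have d1 := @dm 1%N t isT.
rewrite /tilted_mean; apply: is_derive_eq.
rewrite /tilted_var /tilted_mean /GRing.scale/=; field.
by rewrite m00 gt_eqF.
Qed.

(** Up to the factor [m 0 t], this is the tilted integral of [(h - g)^2] with [g] the tilted
    mean. *)
Lemma tilted_var_ge0 (t : R) : 0 <= tilted_var t.
Proof.
have int k : (k <= 4)%N -> mu.-integrable [set: T]
    (EFin \o tilted_integrand beta h w k t).
  by move=> k4; exact: integrable_tilted_integrand.
have intZ k (c : R) : (k <= 4)%N -> mu.-integrable [set: T]
    (EFin \o (fun l => c * tilted_integrand beta h w k t l)).
  by move=> k4; exact: (integrableZl measurableT c (int k k4)).
set g := tilted_mean t.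
have : 0 <= \int[mu]_l ((tilted_integrand beta h w 2 t l -
    2 * g * tilted_integrand beta h w 1 t l) +
    g ^+ 2 * tilted_integrand beta h w 0 t l).
  apply: Rintegral_ge0 => l _; rewrite /tilted_integrand.
  set e := expR _; have -> : w l * h l ^+ 2 * e - 2 * g * (w l * h l ^+ 1 * e) +
      g ^+ 2 * (w l * h l ^+ 0 * e) = w l * ((h l - g) ^+ 2 * e) by ring.
  have /andP[w0 _] := w01 l.
  by rewrite mulr_ge0// mulr_ge0 ?sqr_ge0 ?expR_ge0.
have iB := integrableB measurableT (int 2%N isT) (intZ 1%N (2 * g) isT).
rewrite RintegralD//; last exact: intZ.
rewrite RintegralB//; [|exact: int|exact: intZ].
rewrite !RintegralZl//; [|exact: int|exact: int].
rewrite -/(m 2 t) -/(m 1 t) -/(m 0 t) => ge0.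
have -> : tilted_var t = (m 2 t - 2 * g * m 1 t + g ^+ 2 * m 0 t) / m 0 t.
  rewrite /tilted_var /g /tilted_mean; field.
  by rewrite gt_eqF.
by rewrite divr_ge0// ltW.
Qed.

Lemma continuous_tilted_mean : continuous tilted_mean.
Proof.
move=> t; apply: cvgM; first exact: continuous_m.
by apply: cvgV; [rewrite gt_eqF|exact: continuous_m].
Qed.

Lemma continuous_tilted_var : continuous tilted_var.
Proof.
move=> t; apply: cvgB.
  apply: cvgM; first exact: continuous_m.
  by apply: cvgV; [rewrite gt_eqF|exact: continuous_m].
apply: (@continuous_comp _ _ _ tilted_mean (fun s => s ^+ 2)).
  exact: continuous_tilted_mean.
exact: exprn_continuous.
Qed.

Lemma tilted_mean_nondecreasing : {homo tilted_mean : s t / s <= t}.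
Proof.
move=> s t; rewrite le_eqVlt => /predU1P[->//|st].
have [||c _] := @MVT R tilted_mean (fun u => 2 / beta * tilted_var u) s t st.
  by move=> u _; exact: is_derive_tilted_mean.
- exact/continuous_subspaceT/continuous_tilted_mean.
move=> E; rewrite -subr_ge0 E mulr_ge0 ?subr_ge0 ?(ltW st)//.
by rewrite mulr_ge0 ?tilted_var_ge0// divr_ge0// ltW.
Qed.

Variables (sigma : R) (sigma_gt0 : 0 < sigma).
Hypothesis beta_ge : 4 * sigma ^+ 2 <= beta.

(* Gaussian integration by parts on [-a, a]: the boundary term has the right
   sign because the tilted mean is nondecreasing. *)
Lemma tilted_stein_segment (a : R) : 0 < a ->
  (0 <= \int[L]_(t in `[(- a)%R, a])
    ((tilted_var t - 2 * (t * tilted_mean t)) * normal_pdf 0 sigma t)%:E)%E.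
Proof.
move=> a0; have s0 : sigma != 0 by rewrite gt_eqF.
have aa : - a < a by lra.
set p := normal_pdf 0 sigma.
have cp : continuous p by exact: continuous_normal_pdf.
have dp (t : R) : is_derive t 1 (p : R -> R) (- (t / sigma ^+ 2) * p t).
  rewrite /p normal_pdfE// /normal_fun; apply: is_derive_eq.
  rewrite /GRing.scale/=; set e := expR _; field.
  by rewrite s0.
(* The factor [2 sigma^2] cancels the [1 / sigma^2] of [p' = - (t / sigma^2) p], leaving
   [- 2 t g p]; the variance term comes from the derivative of the tilted mean. *)
pose F (t : R) : R := 2 * sigma ^+ 2 * (tilted_mean t * p t).
pose f (t : R) : R := (4 * sigma ^+ 2 / beta * tilted_var t -
  2 * (t * tilted_mean t)) * p t.
have dF (t : R) : is_derive t 1 F (f t).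
  have := dp t; have := is_derive_tilted_mean t => dg dp'.
  rewrite /F; apply: is_derive_eq.
  rewrite /f /GRing.scale/=; field.
  by rewrite s0 gt_eqF.
have cF : continuous F.
  move=> t; apply: differentiable_continuous; apply/derivable1_diffP.
  by have [] := dF t.
have cf0 (c : R) : continuous (fun t : R => (c * tilted_var t -
    2 * (t * tilted_mean t)) * p t).
  move=> t; apply: cvgM; last exact: cp.
  apply: cvgB.
    by apply: cvgM; [exact: cvg_cst|exact: continuous_tilted_var].
  apply: cvgM; first exact: cvg_cst.
  by apply: cvgM; [exact: cvg_id|exact: continuous_tilted_mean].
have cf : continuous f by exact: cf0.
have ck : continuous (fun t : R =>
    (tilted_var t - 2 * (t * tilted_mean t)) * p t).
  rewrite (_ : (fun t : R => _) = (fun t : R => (1 * tilted_var t -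
    2 * (t * tilted_mean t)) * p t)); first exact: cf0.
  by apply/funext => t; rewrite mul1r.
have intc (k : R -> R) : continuous k ->
    L.-integrable `[- a, a] (EFin \o k).
  move=> ctk; apply: continuous_compact_integrable.
    exact: segment_compact.
  exact: continuous_subspaceT.
have FTC : (\int[L]_(t in `[(- a)%R, a]) (f t)%:E = (F a)%:E - (F (- a))%:E)%E.
  apply: continuous_FTC2 => //.
  - exact: continuous_subspaceT.
  - split.
    + by move=> t _; have [] := dF t.
    + exact/cvg_at_right_filter/cF.
    + exact/cvg_at_left_filter/cF.
  - by move=> t _; rewrite derive1E; exact: derive_val.
have F_ge : (0 <= (F a)%:E - (F (- a))%:E)%E.
  rewrite -EFinB lee_fin /F.
  have -> : p (- a) = p a.
    by rewrite /p normal_pdfE// /normal_fun !subr0 sqrrN.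
  have := tilted_mean_nondecreasing (ltW aa); have := normal_pdf_ge0 0 sigma a.
  rewrite -/p -mulrBr -mulrBl => pa gg.
  apply: mulr_ge0; first by rewrite mulr_ge0 ?sqr_ge0.
  by apply: mulr_ge0 => //; rewrite subr_ge0.
apply: (le_trans F_ge); rewrite -FTC; apply: le_integral => //.
- exact: intc.
- exact: intc.
(* By [beta_ge], [4 sigma^2 / beta <= 1], and the variance that it multiplies is nonnegative. *)
move=> t _; rewrite lee_fin ler_wpM2r ?normal_pdf_ge0// lerD2r.
by rewrite ler_piMl ?tilted_var_ge0// ler_pdivrMr// mul1r.
Qed.

End tilted_stein.

(** * Gaussian noise *)

Section gaussian_coordinate.
Local Open Scope ereal_scope.
Context {R : realType} (n : nat).

Definition tuple_set (i : 'I_n) (t : R) (z : n.-tuple R) : n.-tuple R :=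
  [tuple if k == i then t else tnth z k | k < n].

Lemma measurable_tuple_set i :
  measurable_fun [set: R * n.-tuple R] (fun tz => tuple_set i tz.1 tz.2).
Proof.
apply/measurable_fun_tnthP => k.
rewrite (_ : _ \o _ =
  fun tz => if k == i then tz.1 else tnth tz.2 k); last first.
  by apply/funext => tz /=; rewrite tnth_mktuple.
case: (k == i); first exact: measurable_fst.
apply: (@measurableT_comp _ _ _ _ _ _ (@tnth n R ^~ k)).
  exact: measurable_tnth.
exact: measurable_snd.
Qed.

Lemma tuple_set_set i s t (z : n.-tuple R) :
  tuple_set i s (tuple_set i t z) = tuple_set i s z.
Proof. by apply: eq_from_tnth => k; rewrite !tnth_mktuple; case: eqP. Qed.

Lemma tuple_set_id i (z : n.-tuple R) : tuple_set i (tnth z i) z = z.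
Proof.
by apply: eq_from_tnth => k; rewrite tnth_mktuple; case: eqP => // ->.
Qed.

Definition rectangles : set (set (n.-tuple R)) :=
  [set C | exists B : 'I_n -> set R, (forall k, measurable (B k)) /\
    C = [set z | forall k, B k (tnth z k)]].

(** Unlike the preimages under single coordinates, rectangles are stable under intersection, as
    uniqueness of measures requires. *)
Lemma measurable_tuple_rectangles : @measurable _ (n.-tuple R) = <<s rectangles >>.
Proof.
apply/seteqP; split.
  apply: smallest_sub; first exact: smallest_sigma_algebra.
  rewrite -bigcup_seq => C [/= i _ [B mB <-]]; apply: sub_sigma_algebra.
  exists (fun k => if k == i then B else setT); split => [k|].
    by case: ifP.
  apply/seteqP; split => [z [_ /= Bz] k|z /(_ i)]; last by rewrite eqxx.
  by case: eqP => // ->.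
apply: smallest_sub; first exact: sigma_algebra_measurable.
move=> _ [B [mB ->]].
rewrite (_ : [set z | _] = \bigcap_(k in [set: 'I_n])
    ((@tnth n R)^~ k @^-1` B k)); last first.
  by apply/seteqP; split => [z Bz k _|z Bz k] //=; exact: Bz.
apply: fin_bigcap_measurable => // k _; rewrite -[X in measurable X]setTI.
exact: measurable_tnth.
Qed.

Context d (Omega : measurableType d) (P : probability Omega R).
Variables (sigma : R) (xi : 'I_n -> {RV P >-> R}).
Hypothesis xi_iid : iid_centered_normal sigma xi.

Definition noise (w : Omega) : n.-tuple R := [tuple xi i w | i < n].

Lemma measurable_noise : measurable_fun [set: Omega] noise.
Proof.
apply/measurable_fun_tnthP => k.
rewrite (_ : _ \o _ = xi k); first exact: measurable_funP.
by apply/funext => w /=; rewrite tnth_mktuple.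
Qed.

(** Overwriting slot [i] rather than deleting it forgets [xi i] without changing the tuple type. *)
Let rest i (w : Omega) : n.-tuple R := tuple_set i 0%R (noise w).

Let measurable_rest i : measurable_fun [set: Omega] (rest i).
Proof.
apply: (measurableT_comp (measurable_tuple_set i)
  (g := fun w => (0%R : R, noise w))).
by apply: measurable_fun_pair => //; exact: measurable_noise.
Qed.

HB.instance Definition _ i :=
  isMeasurableFun.Build _ _ _ _ (rest i) (measurable_rest i).

Let split i (w : Omega) : measurableTypeR R * n.-tuple R := (xi i w, rest i w).

Let measurable_split i : measurable_fun [set: Omega] (split i).
Proof.
apply: measurable_fun_pair; last exact: measurable_rest.
have mxi : measurable_fun [set: Omega] (xi i) by exact: measurable_funP.
exact mxi.
Qed.

HB.instance Definition _ i :=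
  isMeasurableFun.Build _ _ _ _ (split i) (measurable_split i).

Let measurable_preim (i : 'I_n) (A : set R) :
  measurable A -> measurable (xi i @^-1` A).
Proof. by move=> mA; rewrite -[X in measurable X]setTI; exact: measurable_funP. Qed.

(** For fixed [A] both sides are finite measures in [B], and mutual independence makes them agree on
    rectangles. *)
Let independent_rest i (A : set R) (B : set (n.-tuple R)) :
  measurable A -> measurable B ->
  P (xi i @^-1` A `&` rest i @^-1` B) = P (xi i @^-1` A) * P (rest i @^-1` B).
Proof.
move=> mA mB; have mXA := measurable_preim i mA.
have PA_fin : P (xi i @^-1` A) \is a fin_num by exact: fin_num_measure.
have PA0 : (0 <= fine (P (xi i @^-1` A)))%R by rewrite fine_ge0.
pose m1 := pushforward (mrestr P mXA) (rest i).
pose m2 := mscale (NngNum PA0) (distribution P (rest i)).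
have m1E C : m1 C = P (rest i @^-1` C `&` xi i @^-1` A) by [].
have m2E C : m2 C = P (xi i @^-1` A) * P (rest i @^-1` C).
  by rewrite -[X in _ = X * _]fineK.
rewrite setIC -m1E -m2E.
apply: (measure_unique rectangles (fun=> setT)) => //.
- exact: measurable_tuple_rectangles.
- move=> _ _ [B1 [mB1 ->]] [B2 [mB2 ->]].
  exists (fun k => B1 k `&` B2 k); split => [k|]; first exact: measurableI.
  apply/seteqP; split => [z [z1 z2] k|z z12]; first by split.
  by split => k; have [] := z12 k.
- by move=> _; exists (fun=> setT); split => //; apply/seteqP; split.
- by apply/seteqP; split => // z _; exists 0%N.
- move=> _ [C [mC ->]]; rewrite [LHS]m1E [RHS]m2E.
  (* Slot [i] of [rest i] is constantly 0: a rectangle whose side [i] misses 0 has an empty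
     preimage, and any other constrains only the remaining coordinates. *)
  have [C0|C0] := pselect (C i 0%R); last first.
    rewrite (_ : rest i @^-1` _ = set0); first by rewrite set0I measure0 mule0.
    apply/seteqP; split => // w /= /(_ i).
    by rewrite tnth_mktuple eqxx.
  have restE : rest i @^-1` [set z | forall k, C k (tnth z k)] =
      \bigcap_(k in [set` [set~ i]%SET]) (xi k @^-1` C k).
    apply/seteqP; split => w /= Cw k.
      by rewrite /= !inE => ki; have := Cw k; rewrite !tnth_mktuple (negbTE ki).
    rewrite !tnth_mktuple; case: eqP => [->//|/eqP ki].
    by apply: Cw; rewrite /= !inE.
  have [indep _] := xi_iid.
  pose A' k := if k == i then A else C k.
  have mA' k : measurable (A' k) by rewrite /A'; case: ifP.
  have A'i : A' i = A by rewrite /A' eqxx.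
  have A'k k : k != i -> A' k = C k by rewrite /A' => /negbTE ->.
  (* Independence is used twice: over all indices with [A] in slot [i], then over the indices other
     than [i] to reassemble the law of [rest i]. *)
  have := indep [set: 'I_n]%SET A' mA'.
  rewrite (bigD1 i) ?inE//= A'i.
  rewrite (_ : \bigcap_(k in _) _ = rest i @^-1`
      [set z | forall k, C k (tnth z k)] `&` xi i @^-1` A); last first.
    rewrite restE; apply/seteqP; split => [w Aw|w [Cw Aw] k _].
      split => [k|]; last by have := Aw i; rewrite A'i /= !inE; exact.
      by rewrite /= !inE => ki; have := Aw k; rewrite A'k//= !inE; exact.
    have [->|ki] := eqVneq k i; first by rewrite A'i.
    by rewrite A'k//; apply: Cw; rewrite /= !inE.
  move=> ->; congr (_ * _); rewrite restE indep//.
  apply: eq_big => k; first by rewrite !inE.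
  by rewrite inE /= => ki; rewrite A'k.
- move=> _; apply: (@le_lt_trans _ _ (P setT)); last first.
    by rewrite probability_setT ltry.
  apply: le_measure; rewrite ?inE//.
  by apply: measurableI => //; rewrite preimage_setT.
Qed.

Local Notation N := (normal_prob 0%R sigma).

Let split_law i (X : set (measurableTypeR R * n.-tuple R)) : measurable X ->
  (N \x distribution P (rest i)) X = distribution P (split i) X.
Proof.
move=> mX; apply: product_measure_unique => // A B mA mB.
have [_ law] := xi_iid.
transitivity (P (xi i @^-1` A `&` rest i @^-1` B)); first by [].
transitivity (P (xi i @^-1` A) * P (rest i @^-1` B)).
  exact: independent_rest mA mB.
by congr (_ * _); exact: (law i A mA).
Qed.

Let split_noise i w : tuple_set i (split i w).1 (split i w).2 = noise w.
Proof.
rewrite /split /rest/= tuple_set_set -[in RHS](tuple_set_id i (noise w)).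
by rewrite tnth_mktuple.
Qed.

(** By [split_law] the pair formed by coordinate [i] and the rest has a product law, so Fubini
    reduces the sign of the expectation to that of the inner integrals. *)
Lemma integral_noise_ge0 i (U : n.-tuple R -> R) :
  measurable_fun [set: n.-tuple R] U ->
  P.-integrable [set: Omega] (EFin \o (U \o noise)) ->
  (forall r, 0 <= \int[N]_t (U (tuple_set i t r))%:E) ->
  0 <= \int[P]_w (U (noise w))%:E.
Proof.
move=> mU iU U0.
pose F (tz : measurableTypeR R * n.-tuple R) : \bar R :=
  (U (tuple_set i tz.1 tz.2))%:E.
have mF : measurable_fun setT F.
  apply/measurable_EFinP.
  exact: (measurableT_comp mU (measurable_tuple_set i)).
have FE : EFin \o (U \o noise) = F \o split i.
  by apply/funext => w; rewrite /F /= split_noise.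
have iF : (distribution P (split i)).-integrable setT F.
  by apply: integrable_pushforward => //; rewrite -FE.
have iF' : (N \x distribution P (rest i)).-integrable setT F.
  move/integrableP : iF => [_ iF]; apply/integrableP; split => //.
  rewrite (@eq_measure_integral _ _ _ _ (distribution P (split i)))//.
  by move=> A mA _; exact: split_law.
have -> : \int[P]_w (U (noise w))%:E = \int[P]_w (F \o split i) w.
  by rewrite -FE.
rewrite -(integral_distribution mF); last by rewrite -FE.
rewrite -(@eq_measure_integral _ _ _ _ (distribution P (split i))
  (N \x distribution P (rest i))); last by move=> A mA _; exact: split_law.
rewrite -integral21_prod_meas1//.
by apply: integral_ge0 => r _; exact: U0.
Qed.

(** Truncating coordinate [i] to a segment brings in the hypothesis; the truncated functions are
    dominated by [|U|] and at each point eventually equal [U]. *)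
Lemma integral_noise_segment_ge0 i (U : n.-tuple R -> R) :
  measurable_fun [set: n.-tuple R] U ->
  P.-integrable [set: Omega] (EFin \o (U \o noise)) ->
  (forall r a, (0 < a)%R -> 0 <= \int[lebesgue_measure]_(t in `[(- a)%R, a])
    (U (tuple_set i t r) * normal_pdf 0 sigma t)%:E) ->
  0 <= \int[P]_w (U (noise w))%:E.
Proof.
move=> mU iU U0.
(* The successor keeps the radius positive, as [U0] demands. *)
pose I (k : nat) : set R := `[(- k.+1%:R)%R, k.+1%:R]%classic.
pose U_ k z := (\1_(I k) (tnth z i) * U z)%R.
have mU_ k : measurable_fun [set: n.-tuple R] (U_ k).
  apply: measurable_funM => //.
  have mI : measurable_fun [set: R] (\1_(I k) : R -> R).
    by apply: measurable_indic; exact: measurable_itv.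
  exact: (measurableT_comp mI (@measurable_tnth _ R n i)).
have U_le k z : (`|U_ k z| <= `|U z|)%R.
  rewrite /U_ normrM indicE; case: (_ \in _); rewrite ?normr1 ?mul1r//.
  by rewrite normr0 mul0r.
have mnoise f : measurable_fun [set: n.-tuple R] f ->
    measurable_fun [set: Omega] (EFin \o ((f : _ -> R) \o noise)).
  move=> mf; apply/measurable_EFinP.
  exact: (measurableT_comp mf measurable_noise).
have cvgU : (\int[P]_w (U_ k (noise w))%:E) @[k --> \oo] -->
    \int[P]_w (U (noise w))%:E.
  have lim w : (U_ k (noise w))%:E @[k --> \oo] --> (U (noise w))%:E.
    apply: cvg_near_cst; exists (Num.truncn `|tnth (noise w) i|) => // k /= ik.
    rewrite /U_ indicE mem_set ?mul1r// /I/= in_itv/= -ler_norml.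
    by rewrite ltW// (lt_le_trans (truncnS_gt _))// ler_nat.
  have dom w k : `|(U_ k (noise w))%:E| <= (EFin \o (Num.norm \o (U \o noise))) w.
    by rewrite lee_fin.
  have [_ _ +] := @dominated_convergence _ _ _ P setT measurableT
    (fun k w => (U_ k (noise w))%:E) (fun w => (U (noise w))%:E) _
    (fun k => mnoise _ (mU_ k)) (mnoise _ mU)
    (aeW _ (fun w _ => lim w)) (integrable_norm iU)
    (aeW _ (fun w k _ => dom w k)).
  by [].
apply: (cvge_ge _ cvgU); apply: nearW => k.
apply: (integral_noise_ge0 (i := i) (mU_ k)) => [|r].
  apply: le_integrable iU => //; first exact: mnoise.
  by move=> w _; rewrite /= lee_fin; exact: U_le.
have mUr : measurable_fun [set: measurableTypeR R]
    (fun t => (U_ k (tuple_set i t r))%:E).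
  apply/measurable_EFinP.
  apply: (measurableT_comp (mU_ k) (g := fun t => tuple_set i t r)).
  apply: (measurableT_comp (measurable_tuple_set i) (g := fun t : R => (t, r))).
  exact: measurable_fun_pair.
rewrite (@integral_density _ (measurableTypeR R) R lebesgue_measure N
  (normal_pdf 0 sigma))//.
- have k0 : (0 < k.+1%:R :> R)%R by rewrite ltr0n.
  apply: (le_trans (U0 r _ k0)); rewrite le_eqVlt; apply/orP; left; apply/eqP.
  rewrite [LHS]integral_mkcond. apply: eq_integral => t _.
  rewrite patchE /U_ tnth_mktuple eqxx indicE -EFinM.
  by rewrite -/(I k); case: ifPn => tI; rewrite ?mul1r// !mul0r.
- by move=> t; exact: normal_pdf_ge0.
- exact: measurable_normal_pdf.
Qed.

End gaussian_coordinate.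

(** * Parametric integrals and Gaussian second moments *)

Section parametric_integral.
Local Open Scope ereal_scope.
Context d1 d2 (T1 : measurableType d1) (T2 : measurableType d2) (R : realType).
Variable mu : {sigma_finite_measure set T2 -> \bar R}.

Lemma measurable_fun_integral (F : T1 * T2 -> \bar R) :
  measurable_fun [set: T1 * T2] F ->
  measurable_fun [set: T1] (fun x => \int[mu]_y F (x, y)).
Proof.
move=> mF.
have -> : (fun x => \int[mu]_y F (x, y)) =
    fubini_F mu F^\+ \- fubini_F mu F^\-.
  apply/funext => x; rewrite integralE /fubini_F.
  congr (_ - _); apply: eq_integral => y _.
    by rewrite !funeposE.
  by rewrite !funenegE.
apply: emeasurable_funB.
- apply: measurable_fun_fubini_tonelli_F => //.
  exact: measurable_funepos.
- apply: measurable_fun_fubini_tonelli_F => //.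
  exact: measurable_funeneg.
Qed.

End parametric_integral.

Lemma Rintegral_sum (R : realType) d (T : measurableType d)
    (mu : {measure set T -> \bar R}) (I : Type) (s : seq I) (f : I -> T -> R) :
  (forall i, mu.-integrable [set: T] (EFin \o f i)) ->
  \int[mu]_x (\sum_(i <- s) f i x) = \sum_(i <- s) \int[mu]_x f i x.
Proof.
move=> intf; rewrite /Rintegral; under eq_integral do rewrite -sumEFin.
rewrite (integral_sum measurableT intf) sum_fine// => i _.
exact: (integrable_fin_num measurableT (intf i)).
Qed.

(** Comparison with the Gaussian density of variance [2 sigma^2]: with [x = t^2 / (4 sigma^2)], [t^2
    exp(- 2 x) = 4 sigma^2 (x exp(- x)) exp(- x) <= 4 sigma^2 exp(- x)]. The ratio of peaks in [c]
    adjusts the normalisations. *)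
Lemma normal_second_moment_lty (R : realType) (sigma : R) : 0 < sigma ->
  (\int[lebesgue_measure]_t (t ^+ 2 * normal_pdf 0 sigma t)%:E < +oo)%E.
Proof.
move=> s0; have sN0 : sigma != 0 by rewrite gt_eqF.
pose s := Num.sqrt 2 * sigma.
have s0' : 0 < s by rewrite mulr_gt0// sqrtr_gt0.
have sN0' : s != 0 by rewrite gt_eqF.
have s2 : s ^+ 2 = 2 * sigma ^+ 2 by rewrite exprMn sqr_sqrtr.
pose c := 4 * sigma ^+ 2 * (normal_peak sigma / normal_peak s).
have p0 : 0 < normal_peak s by exact: normal_peak_gt0.
have c0 : 0 <= c.
  by rewrite mulr_ge0 ?divr_ge0 ?normal_peak_ge0// mulr_ge0 ?sqr_ge0.
have le_pdf t : t ^+ 2 * normal_pdf 0 sigma t <= c * normal_pdf 0 s t.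
  rewrite !normal_pdfE// /normal_fun !subr0 s2.
  set x := t ^+ 2 / (4 * sigma ^+ 2).
  have -> : - t ^+ 2 / (2 * sigma ^+ 2 *+ 2) = - x.
    by rewrite /x -mulr_natr; field.
  have -> : - t ^+ 2 / (sigma ^+ 2 *+ 2) = - x + - x.
    by rewrite /x -mulr_natr; field.
  have -> : c * (normal_peak s * expR (- x)) =
      normal_peak sigma * (4 * sigma ^+ 2 * expR (- x)).
    by rewrite /c; field; rewrite gt_eqF.
  rewrite mulrCA ler_wpM2l ?normal_peak_ge0//.
  have -> : t ^+ 2 = 4 * sigma ^+ 2 * x by rewrite /x; field.
  rewrite expRD; have -> : 4 * sigma ^+ 2 * x * (expR (- x) * expR (- x)) =
      4 * sigma ^+ 2 * (x * expR (- x) * expR (- x)) by ring.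
  have s4 : 0 <= 4 * sigma ^+ 2 by rewrite mulr_ge0 ?sqr_ge0.
  apply: (ler_wpM2l s4); rewrite ler_piMl ?expR_ge0//.
  rewrite expRN ler_pdivrMr ?expR_gt0// mul1r.
  by rewrite (le_trans _ (expR_ge1Dx x))// lerDr.
apply: (@le_lt_trans _ _
  (\int[lebesgue_measure]_t (c * normal_pdf 0 s t)%:E)%E).
  apply: ge0_le_integral => //.
  - by move=> t _; rewrite lee_fin mulr_ge0 ?sqr_ge0 ?normal_pdf_ge0.
  - apply/measurable_EFinP/measurable_funM; last exact: measurable_normal_pdf.
    exact: measurable_funX.
  - apply/measurable_EFinP/measurable_funM => //.
    exact: measurable_normal_pdf.
  - by move=> t _; rewrite lee_fin le_pdf.
under eq_integral do rewrite EFinM.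
rewrite ge0_integralZl ?lee_fin//.
- by rewrite integral_normal_pdf mule1 ltry.
- by apply/measurable_EFinP; exact: measurable_normal_pdf.
- by move=> t _; rewrite lee_fin normal_pdf_ge0.
Qed.

Lemma integrable_noise_sqr (R : realType) (n : nat) d (Omega : measurableType d)
    (P : probability Omega R) (sigma : R) (xi : 'I_n -> {RV P >-> R}) i :
  0 < sigma -> iid_centered_normal sigma xi ->
  P.-integrable [set: Omega] (EFin \o (fun w => xi i w ^+ 2)).
Proof.
move=> s0 [_ law].
have mx : measurable_fun [set: Omega] (xi i) by exact: measurable_funP.
have mX : measurable_fun [set: Omega] (xi i : Omega -> measurableTypeR R).
  exact mx.
apply/integrableP; split.
  exact/measurable_EFinP/measurable_funX.
under eq_integral do rewrite /= ger0_norm ?sqr_ge0//.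
have msq : measurable_fun [set: measurableTypeR R] (fun t : R => (t ^+ 2)%:E).
  exact/measurable_EFinP/measurable_funX.
rewrite -(@ge0_integral_pushforward _ _ _ (measurableTypeR R) R _ mX P setT
  (fun t : R => (t ^+ 2)%:E))//; last first.
  by move=> t _; rewrite lee_fin sqr_ge0.
rewrite (@ge0_integral_density _ (measurableTypeR R) R lebesgue_measure _
  (normal_pdf 0 sigma))//.
- exact: normal_second_moment_lty.
- by move=> t; exact: normal_pdf_ge0.
- exact: measurable_normal_pdf.
- by move=> A mA; exact: (law i A mA).
- by move=> t; rewrite lee_fin sqr_ge0.
Qed.

(** * Risk of the posterior mean *)

Section aggregate_risk.
Context {R : realType} {n : nat} dT (T : measurableType dT).
Variables (mu : probability T R) (beta sigma C : R) (h : 'I_n -> T -> R).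
Hypothesis sigma_gt0 : 0 < sigma.
Hypothesis beta_ge : 4 * sigma ^+ 2 <= beta.
Hypothesis mh : forall i, measurable_fun [set: T] (h i).

Let beta_gt0 : 0 < beta.
Proof. by rewrite (lt_le_trans _ beta_ge)// mulr_gt0// exprn_gt0. Qed.

Definition gibbs (z : n.-tuple R) (l : T) : R :=
  expR (- (\sum_i (tnth z i - h i l) ^+ 2) / beta).

Definition partition_function (z : n.-tuple R) : R := \int[mu]_l gibbs z l.

Definition gibbs_moment i k (z : n.-tuple R) : R :=
  \int[mu]_l (gibbs z l * h i l ^+ k).

Local Notation Z := partition_function.

(** The risk bound depends on the choice of the probability [mu] only through this inequality, which
    also makes [Z] positive. *)
Hypothesis Z_ge : forall z,
  expR (- (C + \sum_i tnth z i ^+ 2) / beta) <= Z z.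

Definition posterior_moment i k (z : n.-tuple R) : R := gibbs_moment i k z / Z z.

Definition posterior_var i (z : n.-tuple R) : R :=
  posterior_moment i 2 z - posterior_moment i 1 z ^+ 2.

Let Z_gt0 z : 0 < Z z. Proof. exact: lt_le_trans (expR_gt0 _) (Z_ge z). Qed.

Let others i (r : n.-tuple R) (l : T) : R :=
  expR (- (\sum_(k | k != i) (tnth r k - h k l) ^+ 2) / beta).

Let others01 i r l : 0 <= others i r l <= 1.
Proof.
rewrite expR_ge0/= expR_le1 mulNr oppr_le0 divr_ge0 ?(ltW beta_gt0)//.
by apply: sumr_ge0 => k _; exact: sqr_ge0.
Qed.

Let measurable_others i r : measurable_fun [set: T] (others i r).
Proof.
apply: measurableT_comp => //; apply: measurable_funM => //.
apply: measurable_funN; under eq_fun do rewrite big_mkcond.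
apply: measurable_sum => k; case: (k != i) => //.
by apply: measurable_funX; exact: measurable_funB.
Qed.

(** The Gibbs weight is a product over the coordinates and only factor [i] involves [t]; posterior
    moments thus become tilted moments with weight [others i r]. *)
Let gibbs_set i k t r l : gibbs (tuple_set i t r) l * h i l ^+ k =
  tilted_integrand beta (h i) (others i r) k t l.
Proof.
rewrite /gibbs /tilted_integrand /others (bigD1 i)//= tnth_mktuple eqxx.
rewrite (eq_bigr (fun k => (tnth r k - h k l) ^+ 2)); last first.
  by move=> j ji; rewrite tnth_mktuple (negbTE ji).
by rewrite opprD mulrDl addrC expRD mulrAC.
Qed.

Let gibbs_moment_set i k t r : gibbs_moment i k (tuple_set i t r) =
  tilted_moment mu beta (h i) (others i r) k t.
Proof. by apply: eq_Rintegral => l _; rewrite gibbs_set. Qed.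

Let partition_set i t r : Z (tuple_set i t r) =
  tilted_moment mu beta (h i) (others i r) 0 t.
Proof.
rewrite -gibbs_moment_set; apply: eq_Rintegral => l _.
by rewrite expr0 mulr1.
Qed.

Let mu_fin : (mu [set: T] < +oo)%E.
Proof. by rewrite probability_setT ltry. Qed.

Let integrable_gibbs_moment i k z : (k <= 4)%N ->
  mu.-integrable [set: T] (EFin \o (fun l => gibbs z l * h i l ^+ k)).
Proof.
move=> k4; rewrite -(tuple_set_id i z).
rewrite (_ : (fun l => _) =
    tilted_integrand beta (h i) (others i z) k (tnth z i)); last first.
  by apply/funext => l; rewrite gibbs_set.
exact: integrable_tilted_integrand.
Qed.

Let gibbs_le1 z l : gibbs z l <= 1.
Proof.
rewrite expR_le1 mulNr oppr_le0 divr_ge0 ?(ltW beta_gt0)//.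
by apply: sumr_ge0 => k _; exact: sqr_ge0.
Qed.

Let measurable_gibbs2 :
  measurable_fun [set: n.-tuple R * T] (fun zl => gibbs zl.1 zl.2).
Proof.
apply: measurableT_comp => //; apply: measurable_funM => //.
apply: measurable_funN; apply: measurable_sum => k.
apply: measurable_funX; apply: measurable_funB.
- exact: (measurableT_comp (@measurable_tnth _ R n k) measurable_fst).
- exact: (measurableT_comp (mh k) measurable_snd).
Qed.

Let measurable_gibbs z : measurable_fun [set: T] (gibbs z).
Proof.
exact: (measurableT_comp measurable_gibbs2 (@pair1_measurable _ _ _ T z)).
Qed.

Lemma integrable_gibbs z : mu.-integrable [set: T] (EFin \o gibbs z).
Proof.
apply: measurable_bounded_integrable => //.
exists 1; split; first by rewrite num_real.
by move=> b b1 l _ /=; rewrite ger0_norm ?expR_ge0// (le_trans _ (ltW b1)).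
Qed.

(** Taken at [b = f (x i)], where [b + h i] is the fitted value, it identifies the error of the
    aggregate with a posterior mean. *)
Lemma integral_gibbs_affine i z (b : R) :
  \int[mu]_l (gibbs z l / Z z * (b + h i l)) = b + posterior_moment i 1 z.
Proof.
have i0 := integrable_gibbs z.
have i1 := @integrable_gibbs_moment i 1%N z isT.
have E l : gibbs z l / Z z * (b + h i l) =
    b / Z z * gibbs z l + (Z z)^-1 * (gibbs z l * h i l ^+ 1) by ring.
under eq_Rintegral do rewrite E.
rewrite RintegralD//; last 2 first.
- exact: (integrableZl measurableT (b / Z z) i0).
- exact: (integrableZl measurableT (Z z)^-1 i1).
rewrite !RintegralZl// -/(Z z) -/(gibbs_moment i 1 z) divfK ?gt_eqF//.
by rewrite mulrC.
Qed.

Lemma measurable_partition_function : measurable_fun [set: n.-tuple R] Z.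
Proof.
apply: (measurableT_comp (fine_measurable measurableT)).
apply: (@measurable_fun_integral _ _ _ _ _ mu
  (fun zl => (gibbs zl.1 zl.2)%:E)).
exact/measurable_EFinP.
Qed.

Lemma measurable_posterior_moment i k :
  measurable_fun [set: n.-tuple R] (posterior_moment i k).
Proof.
apply: measurable_funM; last first.
  (* Since [Z] is positive, its inverse is [exp (- ln Z)], a composition of measurable functions. *)
  rewrite (_ : (fun z => (Z z)^-1) = expR \o -%R \o (@ln R) \o Z).
    apply: measurableT_comp; last exact: measurable_partition_function.
    apply: measurableT_comp; last exact: measurable_ln.
    exact: measurableT_comp.
  by apply/funext => z /=; rewrite expRN lnK // posrE; exact: Z_gt0.
apply: (measurableT_comp (fine_measurable measurableT)).
apply: (@measurable_fun_integral _ _ _ _ _ mu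
  (fun zl => (gibbs zl.1 zl.2 * h i zl.2 ^+ k)%:E)).
apply/measurable_EFinP/measurable_funM => //; apply: measurable_funX.
exact: (measurableT_comp (mh i) measurable_snd).
Qed.

Let sum_sqr_ge0 (z : n.-tuple R) : 0 <= \sum_i tnth z i ^+ 2.
Proof. by apply: sumr_ge0 => i _; exact: sqr_ge0. Qed.

(* With G = exp (- E) the Gibbs weight, integrate G (1 + E + ln Z) <= Z against
   the prior: the posterior mean of the energy E is at most - ln Z, which Z_ge
   bounds from above. *)
Lemma posterior_energy_le z :
  \sum_i (posterior_moment i 2 z - 2 * (tnth z i * posterior_moment i 1 z)) <= C.
Proof.
pose S := \sum_i tnth z i ^+ 2.
(* Multiplied by [beta], the constant of the tangent inequality is [beta - C - S]. The energy gives
   [S] back, as [(t - h)^2 = t^2 - 2 t h + h^2], so [beta - C] remains. *)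
pose a := beta - C.
have ptw l : gibbs z l * a - \sum_i (2 * tnth z i * (gibbs z l * h i l ^+ 1)) +
    \sum_i gibbs z l * h i l ^+ 2 <= beta * Z z.
  have -> : gibbs z l * a - \sum_i (2 * tnth z i * (gibbs z l * h i l ^+ 1)) +
      \sum_i gibbs z l * h i l ^+ 2 =
      gibbs z l * (a - S + \sum_i (tnth z i - h i l) ^+ 2).
    have -> : \sum_i (tnth z i - h i l) ^+ 2 =
        S - \sum_i 2 * tnth z i * h i l + \sum_i h i l ^+ 2.
      by rewrite /S -sumrB -big_split/=; apply: eq_bigr => i _; ring.
    rewrite (eq_bigr (fun i => gibbs z l * (2 * tnth z i * h i l))); last first.
      by move=> i _; ring.
    by rewrite -!mulr_sumr; ring.
  rewrite /gibbs; set E := \sum_i (tnth z i - h i l) ^+ 2.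
  rewrite mulNr expRN mulrC ler_pdivrMr ?expR_gt0//.
  have b0 := beta_gt0.
  have EF : 1 + (E / beta - (C + S) / beta) <=
      expR (E / beta - (C + S) / beta) by exact: expR_ge1Dx.
  have -> : a - S + E = beta * (1 + (E / beta - (C + S) / beta)).
    by rewrite /a; field; rewrite gt_eqF.
  rewrite -mulrA ler_pM2l//; apply: (le_trans EF).
  rewrite expRD mulrC ler_wpM2r ?expR_ge0// -mulNr.
  exact: Z_ge.
have i0 := integrable_gibbs z.
have int1 i : mu.-integrable [set: T]
    (EFin \o (fun l => 2 * tnth z i * (gibbs z l * h i l ^+ 1))).
  exact: (integrableZl measurableT (2 * tnth z i)
    (@integrable_gibbs_moment i 1%N z isT)).
have int2 i : mu.-integrable [set: T] (EFin \o (fun l => gibbs z l * h i l ^+ 2)).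
  exact: integrable_gibbs_moment.
have intS (f : 'I_n -> T -> R) :
    (forall i, mu.-integrable [set: T] (EFin \o f i)) ->
    mu.-integrable [set: T] (EFin \o (fun l => \sum_i f i l)).
  move=> intf; rewrite (_ : EFin \o _ = (fun l => \sum_i (f i l)%:E)%E).
    exact: (integrable_sum measurableT _ (fun i _ => intf i)).
  by apply/funext => l /=; rewrite sumEFin.
have ia : mu.-integrable [set: T] (EFin \o (fun l => gibbs z l * a)).
  exact: (integrableZr measurableT a i0).
have iB := integrableB measurableT ia (intS _ int1).
have iD := integrableD measurableT iB (intS _ int2).
have icst : mu.-integrable [set: T] (EFin \o cst (beta * Z z)).
  exact: finite_measure_integrable_cst.
have := le_Rintegral measurableT iD icst (fun l _ => ptw l).
rewrite RintegralD//; last exact: intS.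
rewrite RintegralB//; last exact: intS.
rewrite !Rintegral_sum// RintegralZr// Rintegral_cst//=.
rewrite probability_setT mulr1.
rewrite (eq_bigr (fun i => 2 * tnth z i * gibbs_moment i 1 z)); last first.
  by move=> i _; rewrite RintegralZl//; exact: integrable_gibbs_moment.
rewrite -/(Z z) -[X in _ + X <= _]/(\sum_i gibbs_moment i 2 z) => le.
rewrite sumrB.
have -> : \sum_i posterior_moment i 2 z = (\sum_i gibbs_moment i 2 z) / Z z.
  by rewrite mulr_suml.
have -> : \sum_i 2 * (tnth z i * posterior_moment i 1 z) =
    (\sum_i 2 * tnth z i * gibbs_moment i 1 z) / Z z.
  by rewrite mulr_suml; apply: eq_bigr => i _; rewrite /posterior_moment !mulrA.
rewrite -mulrBl ler_pdivrMr//; move: le; rewrite /a; lra.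
Qed.

Lemma posterior_var_ge0 i z : 0 <= posterior_var i z.
Proof.
rewrite /posterior_var /posterior_moment -(tuple_set_id i z).
rewrite !gibbs_moment_set partition_set.
apply: tilted_var_ge0 => // t.
by rewrite -partition_set.
Qed.

(** In the energy bound, [2 t g <= 2 t^2 + g^2 / 2 <= 2 t^2 + v / 2], with [v] the second moment,
    and half of the sum of the [v] is absorbed on the left. A bound quadratic in the noise makes the
    Stein integrands integrable. *)
Lemma posterior_second_moment_le z :
  \sum_i posterior_moment i 2 z <= 2 * C + 4 * \sum_i tnth z i ^+ 2.
Proof.
have := posterior_energy_le z; rewrite sumrB => le.
have : \sum_i 2 * (tnth z i * posterior_moment i 1 z) <=
    \sum_i (2 * tnth z i ^+ 2 + posterior_moment i 2 z / 2).
  apply: ler_sum => i _; have := posterior_var_ge0 i z.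
  rewrite /posterior_var; set g := posterior_moment i 1 z.
  set v := posterior_moment i 2 z; set t := tnth z i => V0.
  rewrite -subr_ge0 (_ : _ - _ = ((2 * t - g) ^+ 2 + (v - g ^+ 2)) / 2).
    by rewrite divr_ge0// addr_ge0// sqr_ge0.
  by field.
rewrite big_split/= -[X in _ <= X + _]mulr_sumr -[X in _ <= _ + X]mulr_suml.
by move: le; lra.
Qed.

Context d (Omega : measurableType d) (P : probability Omega R).
Variables (xi : 'I_n -> {RV P >-> R}).
Hypothesis xi_iid : iid_centered_normal sigma xi.

Let stein_gap i (z : n.-tuple R) : R :=
  posterior_var i z - 2 * (tnth z i * posterior_moment i 1 z).

Let measurable_stein_gap i : measurable_fun [set: n.-tuple R] (stein_gap i).
Proof.
have mg := measurable_posterior_moment i.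
apply: measurable_funB.
  by apply: measurable_funB; [exact: mg|apply: measurable_funX; exact: mg].
apply: measurable_funM => //; apply: measurable_funM; last exact: mg.
exact: measurable_tnth.
Qed.

Let posterior_moment2_ge0 i z : 0 <= posterior_moment i 2 z.
Proof.
have := posterior_var_ge0 i z; rewrite /posterior_var.
by have := sqr_ge0 (posterior_moment i 1 z); lra.
Qed.

Let posterior_moment_le i z :
  posterior_moment i 2 z <= 2 * C + 4 * \sum_i tnth z i ^+ 2.
Proof.
apply: le_trans (posterior_second_moment_le z).
by rewrite (bigD1 i)//= lerDl sumr_ge0.
Qed.

(** In [V + 2 |t g|] with [2 |t g| <= t^2 + g^2], the [g^2] cancels the one inside [V], leaving
    [v + t^2], with [v] the second moment. *)
Let stein_gap_le i z :
  `|stein_gap i z| <= 4 * C + 9 * \sum_i tnth z i ^+ 2.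
Proof.
have := posterior_moment_le i z; have := posterior_var_ge0 i z.
have zi : tnth z i ^+ 2 <= \sum_i tnth z i ^+ 2.
  by rewrite (bigD1 i)//= lerDl sumr_ge0// => k _; exact: sqr_ge0.
rewrite /stein_gap /posterior_var; set g := posterior_moment i 1 z.
set v := posterior_moment i 2 z; set t := tnth z i in zi *.
set S := \sum_i tnth z i ^+ 2 in zi *; move=> V0 vle.
have tg : `|2 * (t * g)| <= t ^+ 2 + g ^+ 2.
  rewrite ler_norml; apply/andP; split; rewrite -subr_ge0.
    by rewrite (_ : _ - _ = (t + g) ^+ 2) ?sqr_ge0//; ring.
  by rewrite (_ : _ - _ = (t - g) ^+ 2) ?sqr_ge0//; ring.
have := ler_normB (v - g ^+ 2) (2 * (t * g)); rewrite (ger0_norm V0).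
by have := sqr_ge0 g; lra.
Qed.

Let integrable_bound (a b : R) : P.-integrable [set: Omega]
  (EFin \o (fun w => a + b * \sum_i tnth (noise xi w) i ^+ 2)).
Proof.
have isum : P.-integrable [set: Omega]
    (fun w => (\sum_i (xi i w ^+ 2)%:E)%E).
  apply: (integrable_sum measurableT _ (fun i _ => _)) => i _.
  exact: integrable_noise_sqr sigma_gt0 xi_iid.
have ia : P.-integrable [set: Omega] (EFin \o cst a).
  exact: finite_measure_integrable_cst.
rewrite (_ : EFin \o _ =
    (EFin \o cst a) \+ (fun w => b%:E * \sum_i (xi i w ^+ 2)%:E))%E.
  by apply: (integrableD measurableT) => //; exact: integrableZl.
apply/funext => w; rewrite /= sumEFin -EFinM -EFinD; congr (_ + _ * _)%:E.
by apply: eq_bigr => i _; rewrite tnth_mktuple.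
Qed.

Let integrable_stein_gap i :
  P.-integrable [set: Omega] (EFin \o (stein_gap i \o noise xi)).
Proof.
apply: (le_integrable measurableT _ _ (integrable_bound (4 * C) 9)).
  apply/measurable_EFinP.
  exact: (measurableT_comp (@measurable_stein_gap i) (measurable_noise xi)).
move=> w _; rewrite /= lee_fin [leRHS]ger0_norm; first exact: stein_gap_le.
exact: le_trans (normr_ge0 _) (stein_gap_le i _).
Qed.

Let integral_stein_gap_ge0 i :
  (0 <= \int[P]_w (stein_gap i (noise xi w))%:E)%E.
Proof.
apply: (integral_noise_segment_ge0 xi_iid (i := i)) => //.
move=> r a a0.
have m0 t : 0 < tilted_moment mu beta (h i) (others i r) 0 t.
  by rewrite -partition_set.
have := tilted_stein_segment mu_fin beta_gt0 (mh i) (@measurable_others i r)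
  (others01 i r) m0 sigma_gt0 beta_ge a0.
congr (_ <= _)%E; apply: eq_integral => t _; congr ((_ * _)%:E).
rewrite /stein_gap /posterior_var /posterior_moment tnth_mktuple eqxx.
by rewrite !gibbs_moment_set partition_set.
Qed.

Lemma posterior_mean_risk :
  (\int[P]_w (\sum_i posterior_moment i 1 (noise xi w) ^+ 2)%:E <= C%:E)%E.
Proof.
have isum : P.-integrable [set: Omega]
    (fun w => (\sum_i (stein_gap i (noise xi w))%:E)%E).
  exact: (integrable_sum measurableT _ (fun i _ => integrable_stein_gap i)).
have iC : P.-integrable [set: Omega] (EFin \o cst C).
  exact: finite_measure_integrable_cst.
(* Pointwise, [g_i^2 = (v_i - 2 xi_i g_i) - stein_gap i], and the brackets sum to at most [C] by
   [posterior_energy_le]. *)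
apply: (@le_trans _ _ (\int[P]_w (C%:E -
    \sum_i (stein_gap i (noise xi w))%:E))%E).
  apply: ge0_le_integral => //.
  - by move=> w _; rewrite lee_fin sumr_ge0// => i _; exact: sqr_ge0.
  - apply/measurable_EFinP/measurable_sum => i; apply: measurable_funX.
    exact: (measurableT_comp (measurable_posterior_moment i 1)
      (measurable_noise xi)).
  - exact: (measurable_int P (integrableB measurableT iC isum)).
  - move=> w _; rewrite sumEFin -EFinB lee_fin.
    have := posterior_energy_le (noise xi w).
    rewrite /stein_gap /posterior_var !sumrB; lra.
rewrite integralB// integral_cst//= probability_setT mule1.
rewrite leeBlDr; last exact: (integrable_fin_num measurableT isum).
rewrite (integral_sum measurableT integrable_stein_gap).
by apply/leeDl/sume_ge0 => i _; exact: integral_stein_gap_ge0.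
Qed.

End aggregate_risk.

(** * Lower bound on the normalising constant *)

Section as_probability.
Context d (T : measurableType d) (R : realType) (m : {measure set T -> \bar R}).

(** The prior is given as a bare measure whose mass is a proved fact; an alias that takes this proof
    as argument can carry the probability structure. *)
Definition as_probability (m1 : m [set: T] = 1%E) : set T -> \bar R := m.

HB.instance Definition _ m1 := Measure.copy (as_probability m1) m.

HB.instance Definition _ m1 :=
  Measure_isProbability.Build _ _ _ (as_probability m1) m1.

End as_probability.

(* Jensen's inequality for exp, via its tangent line at - e. *)
Lemma expRN_le_integral (R : realType) d (T : measurableType d)
    (mu : {measure set T -> \bar R}) (E : T -> R) (e : R) :
  mu [set: T] = 1%E -> 0 <= e -> measurable_fun [set: T] E ->
  (forall l, 0 <= E l) -> (\int[mu]_l (E l)%:E <= e%:E)%E ->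
  ((expR (- e))%:E <= \int[mu]_l (expR (- E l))%:E)%E.
Proof.
move=> mu1 e0 mE E0 Ee.
have mexp : measurable_fun [set: T] (fun l => (expR (- E l))%:E).
  by apply/measurable_EFinP; apply: measurableT_comp => //; exact: measurable_funN.
have mEE : measurable_fun [set: T] (EFin \o E) by exact/measurable_EFinP.
(* [E] stays on the side of the exponential, so that only nonnegative functions are integrated; the
   finite term [e exp(- e)] is cancelled afterwards. *)
have tangent : ((expR (- e) * (1 + e))%:E <=
    \int[mu]_l (expR (- E l))%:E + (expR (- e))%:E * \int[mu]_l (E l)%:E)%E.
  have EE0 l : [set: T] l -> (0 <= (E l)%:E)%E by rewrite lee_fin.
  rewrite -(ge0_integralZl_EFin _ measurableT EE0 mEE (expR_ge0 _)).
  rewrite -ge0_integralD//; last 2 first.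
  - by move=> l _; rewrite -EFinM lee_fin mulr_ge0 ?expR_ge0.
  - exact: measurable_funeM.
  rewrite -[leLHS]mule1 -mu1 -integral_cst//; apply: ge0_le_integral => //.
  - by move=> l _; rewrite lee_fin mulr_ge0 ?expR_ge0// addr_ge0.
  - by apply: emeasurable_funD => //; exact: measurable_funeM.
  move=> l _; rewrite -EFinM -EFinD lee_fin.
  have -> : - E l = - e + (e - E l) by rewrite addKr.
  rewrite expRD; have := expR_ge1Dx (e - E l); have := expR_gt0 (- e).
  by set p := expR (- e); set r := expR (e - E l); nra.
rewrite -(@leeD2rE _ ((expR (- e))%:E * e%:E)%E)//.
apply: (@le_trans _ _ (expR (- e) * (1 + e))%:E).
  by rewrite -EFinM -EFinD lee_fin mulrDr mulr1.
apply: (le_trans tangent); rewrite leeD2l//.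
by rewrite lee_pmul2l// ?lte_fin ?expR_gt0.
Qed.

Section sparsity_partition.
Context {R : realType} (n M : nat).
Variables (tau beta s : R) (prior : {measure set (M.-tuple R) -> \bar R}).
Variables (c : 'I_n -> 'I_M -> R) (a : M.-tuple R).
Hypothesis tau_gt0 : 0 < tau.
Hypothesis beta_gt0 : 0 < beta.
Hypothesis priorE : forall A : set (M.-tuple R), measurable A ->
  prior A = (\int[lebesgue_tuple M]_(lam in A)
               (sparsity_density tau lam)%:E)%E.
Hypothesis c_le : tau ^+ 2 * \sum_i \sum_j c i j ^+ 2 <= s.

Definition centered_fit i (lam : M.-tuple R) : R :=
  \sum_j c i j * (tnth lam j - tnth a j).

Lemma measurable_centered_fit i :
  measurable_fun [set: M.-tuple R] (centered_fit i).
Proof.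
apply: measurable_sum => j; apply: measurable_funM => //.
by apply: measurable_funB => //; exact: measurable_tnth.
Qed.

Lemma centered_fit_shift i z :
  centered_fit i (tuple_shift a z) = \sum_j c i j * tnth z j.
Proof.
by apply: eq_bigr => j _; rewrite tnth_mktuple addrK.
Qed.

Lemma sparsity_partition_ge (z : n.-tuple R) :
  ((expR (- (beta * shift_cost tau a + s + \sum_i tnth z i ^+ 2) / beta))%:E <=
   \int[prior]_lam (gibbs beta centered_fit z lam)%:E)%E.
Proof.
pose e := (s + \sum_i tnth z i ^+ 2) / beta.
pose E (lam : M.-tuple R) :=
  (\sum_i (tnth z i - \sum_j c i j * tnth lam j) ^+ 2) / beta.
have prior1 := sparsity_prior_setT tau_gt0 priorE.
have mterm i : measurable_fun [set: M.-tuple R]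
    (fun lam => (tnth z i - \sum_j c i j * tnth lam j) ^+ 2).
  apply: measurable_funX; apply: measurable_funB => //.
  apply: measurable_sum => j; apply: measurable_funM => //.
  exact: measurable_tnth.
have mE : measurable_fun [set: M.-tuple R] E.
  by apply: measurable_funM => //; exact: measurable_sum.
have E0 lam : 0 <= E lam.
  rewrite divr_ge0 ?(ltW beta_gt0)// sumr_ge0// => i _; exact: sqr_ge0.
have s0 : 0 <= s.
  apply: le_trans c_le; rewrite mulr_ge0 ?sqr_ge0// sumr_ge0// => i _.
  by rewrite sumr_ge0// => j _; exact: sqr_ge0.
have e0 : 0 <= e.
  rewrite divr_ge0 ?(ltW beta_gt0)// addr_ge0// sumr_ge0// => i _.
  exact: sqr_ge0.
have Ee : (\int[prior]_lam (E lam)%:E <= e%:E)%E.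
  have -> : (\int[prior]_lam (E lam)%:E)%E = ((beta^-1)%:E *
      \sum_i \int[prior]_lam
        ((tnth z i - \sum_j c i j * tnth lam j) ^+ 2)%:E)%E.
    rewrite -ge0_integral_sum//; last 2 first.
    - by move=> i; exact/measurable_EFinP.
    - by move=> i lam _; rewrite lee_fin sqr_ge0.
    rewrite -ge0_integralZl//; last 3 first.
    - apply: emeasurable_sum => i; exact/measurable_EFinP.
    - by move=> lam _; apply: sume_ge0 => i _; rewrite lee_fin sqr_ge0.
    - by rewrite lee_fin invr_ge0 ltW.
    by apply: eq_integral => lam _; rewrite sumEFin -EFinM mulrC.
  under eq_bigr do rewrite (sparsity_prior_second_moment tau_gt0 priorE).
  rewrite sumEFin -EFinM lee_fin /e mulrC ler_pM2r ?invr_gt0//.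
  by rewrite big_split/= addrC lerD2r -mulr_sumr.
have jensen := expRN_le_integral prior1 e0 mE E0 Ee.
have mG : measurable_fun [set: M.-tuple R]
    (fun lam => (gibbs beta centered_fit z lam)%:E).
  apply/measurable_EFinP; apply: measurableT_comp => //.
  apply: measurable_funM => //; apply: measurable_funN.
  apply: measurable_sum => i; apply: measurable_funX.
  by apply: measurable_funB => //; exact: measurable_centered_fit.
have G0 lam : (0 <= (gibbs beta centered_fit z lam)%:E)%E.
  by rewrite lee_fin expR_ge0.
(* Translating by [a] removes the centring of the fit, so the exponent becomes [E], whose prior mean
   is at most [e]; the price is [shift_cost tau a]. *)
apply: le_trans (sparsity_prior_shift_le tau_gt0 priorE a mG G0).
have -> : - (beta * shift_cost tau a + s + \sum_i tnth z i ^+ 2) / beta =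
    - shift_cost tau a + - e by rewrite /e; field; rewrite gt_eqF.
rewrite expRD EFinM lee_pmul2l ?lte_fin ?expR_gt0//.
apply: (le_trans jensen); rewrite le_eqVlt; apply/orP; left; apply/eqP.
apply: eq_integral => lam _; rewrite /gibbs /E mulNr.
by under [in RHS]eq_bigr do rewrite centered_fit_shift.
Qed.

End sparsity_partition.

(** * Bound on the cost of translating the prior *)

Section shift_cost_bound.
Context {R : realType}.

(** For [u <= 1] the left side is at most [u]; for [u > 1] it is at most [ln 2 + ln u], and
    [ln 2 <= 1]. *)
Lemma ln1D_le_logp (u : R) : 0 <= u -> ln (1 + u) <= 1 + logp u.
Proof.
move=> u0; have [u1|u1] := leP u 1.
  rewrite (le_trans (le_ln1Dx _))//; first by lra.
  by rewrite (le_trans u1)// lerDl /logp le_max lexx orbT.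
have u2 : ln (1 + u) <= ln (2 * u) by rewrite ler_ln ?posrE; lra.
rewrite (le_trans u2)// lnM ?posrE//; last by lra.
rewrite lerD//; last by rewrite /logp le_max lexx.
by have := @le_ln1Dx R 1; lra.
Qed.

Lemma shift_cost_le M (tau : R) (a : M.-tuple R) : 0 < tau ->
  shift_cost tau a <= 4 * (sparsity a)%:R *
    (1 + logp (l1norm a / (tau * (sparsity a)%:R))).
Proof.
move=> tau0; rewrite /shift_cost -mulrA ler_wpM2l//.
pose J := [set j | tnth a j != 0]%SET.
have sumJ (g : R -> R) : g 0 = 0 ->
    \sum_j g `|tnth a j| = \sum_(j in J) g `|tnth a j|.
  move=> g0; rewrite [RHS]big_mkcond; apply: eq_bigr => j _; rewrite inE.
  by case: eqP => //= ->; rewrite normr0.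
rewrite (sumJ (fun t => ln (1 + t / tau))) ?mul0r ?addr0 ?ln1//.
have cardJ : sparsity a = #|J|.
  by apply: eq_card => j; apply/idP/idP; rewrite !inE.
(* An empty support makes both sides 0; it is set apart because [m] divides by its size. *)
have [s0|s_gt0] := posnP (sparsity a).
  by rewrite s0 mul0r (cards0_eq (etrans (esym cardJ) s0)) big_set0.
set s : R := (sparsity a)%:R.
have s_gt0' : 0 < s by rewrite ltr0n.
set m := l1norm a / (tau * s).
have l0 : 0 <= l1norm a by apply: sumr_ge0.
have m0 : 0 <= m by rewrite divr_ge0// mulr_ge0// ltW.
have m1 : 0 < 1 + m by lra.
have sE : \sum_(j in J) 1 = s by rewrite sumr_const -cardJ.
apply: (@le_trans _ _ (s * ln (1 + m))); last first.
  by rewrite ler_pM2l// ln1D_le_logp.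
(* The tangent line of ln at 1 + m, where m is the mean of the |a_j| / tau
   over the support of a. *)
have tangent j : ln (1 + `|tnth a j| / tau) <=
    ln (1 + m) * 1 + ((`|tnth a j| / tau) / (1 + m) - m / (1 + m) * 1).
  set t := `|tnth a j| / tau.
  have t0 : 0 <= t by rewrite divr_ge0// ltW.
  have -> : 1 + t = (1 + m) * (1 + (t - m) / (1 + m)).
    by field; rewrite gt_eqF.
  have tm : -1 < (t - m) / (1 + m) by rewrite ltr_pdivlMr//; lra.
  rewrite lnM ?posrE//; last by lra.
  by have := le_ln1Dx tm; rewrite !mulr1 mulrBl; lra.
apply: (le_trans (ler_sum _ (fun j _ => tangent j))).
rewrite big_split/= sumrB -!mulr_sumr sE -!mulr_suml -(sumJ id)//.
rewrite -/(l1norm a) mulrC gerDl le_eqVlt; apply/orP; left; apply/eqP.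
(* The linear parts of the tangents sum to zero, because the [|a_j| / tau] sum to [m * s]. *)
have -> : l1norm a / tau = m * s by rewrite /m; field; rewrite !gt_eqF.
ring.
Qed.

End shift_cost_bound.

Theorem corollary4 (R : realType) (X : Type) (n M : nat)
  (n_gt0 : (0 < n)%N) (M_gt0 : (0 < M)%N)
  (x : 'I_n -> X) (f : X -> R) (phi : 'I_M -> X -> R)
  (d : measure_display) (Omega : measurableType d) (P : probability Omega R)
  (xi : 'I_n -> {RV P >-> R}) (sigma beta phi0 tau : R)
  (sigma_gt0 : 0 < sigma)
  (xi_iid : iid_centered_normal sigma xi)
  (beta_ge : 4 * sigma ^+ 2 <= beta)
  (phi0_gt0 : 0 < phi0)
  (phi_le : forall j : 'I_M, sqnorm_n (phi j \o x) <= phi0)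
  (tauE : tau = sigma / Num.sqrt (phi0 * n%:R * M%:R))
  (prior : {measure set (M.-tuple R) -> \bar R})
  (priorE : forall A : set (M.-tuple R), measurable A ->
     prior A = (\int[lebesgue_tuple M]_(lam in A)
                  (sparsity_density tau lam)%:E)%E)
  (Y : 'I_n -> Omega -> R)
  (YE : forall i w, Y i w = f (x i) + xi i w)
  (lamstar : M.-tuple R)
  (fE : f = flin phi lamstar) :
  ('E_P [fun w => sqnorm_n
           (fun i => ewa x phi beta prior (Y ^~ w) (x i) - f (x i))%R] <=
   (4 * beta / n%:R * (sparsity lamstar)%:R *
      (1 + logp (Num.sqrt (phi0 * n%:R * M%:R) /
                 ((sparsity lamstar)%:R * sigma) * l1norm lamstar))
    + sigma ^+ 2 / n%:R)%:E)%E.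
Proof.
have n0 : 0 < n%:R :> R by rewrite ltr0n.
have M0 : 0 < M%:R :> R by rewrite ltr0n.
have beta_gt0 : 0 < beta.
  by rewrite (lt_le_trans _ beta_ge)// mulr_gt0// exprn_gt0.
have prod_gt0 : 0 < phi0 * n%:R * M%:R by rewrite !mulr_gt0.
set r := Num.sqrt (phi0 * n%:R * M%:R) in tauE *.
have r_gt0 : 0 < r by rewrite sqrtr_gt0.
have tau_gt0 : 0 < tau by rewrite tauE divr_gt0.
have tau2 : tau ^+ 2 * (phi0 * n%:R * M%:R) = sigma ^+ 2.
  by rewrite tauE expr_div_n sqr_sqrtr ?ltW// divfK ?gt_eqF.
pose c i j := phi j (x i).
pose h := centered_fit c lamstar.
(* Summing over the design points first, each [phi j] contributes at most [n phi0]; the choice of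
   [tau] makes the total over [j] exactly [sigma^2]. *)
have c_le : tau ^+ 2 * \sum_i \sum_j c i j ^+ 2 <= sigma ^+ 2.
  rewrite -tau2 ler_wpM2l ?sqr_ge0// exchange_big/=.
  apply: (@le_trans _ _ (\sum_(j < M) n%:R * phi0)).
    apply: ler_sum => j _; have := phi_le j.
    by rewrite /sqnorm_n ler_pdivrMl.
  by rewrite sumr_const card_ord -[leLHS]mulr_natr [n%:R * phi0]mulrC.
have mu1 := sparsity_prior_setT tau_gt0 priorE.
pose mu : probability (M.-tuple R) R := as_probability mu1.
pose C := beta * shift_cost tau lamstar + sigma ^+ 2.
have mh i : measurable_fun [set: M.-tuple R] (h i).
  exact: measurable_centered_fit.
have Z_ge z : expR (- (C + \sum_i tnth z i ^+ 2) / beta) <=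
    partition_function mu beta h z.
  have iG := integrable_gibbs mu sigma_gt0 beta_ge mh z.
  rewrite -lee_fin fineK; last exact: (integrable_fin_num measurableT iG).
  have H := sparsity_partition_ge lamstar tau_gt0 beta_gt0 priorE c_le z.
  (* Integrals against [mu] and against [prior] agree by conversion, [as_probability] being an
     alias. *)
  exact H.
have risk := posterior_mean_risk sigma_gt0 beta_ge mh Z_ge xi_iid.
have fitE i lam : flin phi lam (x i) = f (x i) + h i lam.
  rewrite fE /h /centered_fit /flin -big_split/=; apply: eq_bigr => j _.
  by rewrite /c; ring.
have gibbsE w lam : gibbs_weight x phi beta (Y ^~ w) lam =
    gibbs beta h (noise xi w) lam.
  rewrite /gibbs_weight /gibbs /sqnorm_n mulVKf ?gt_eqF//.
  rewrite (eq_bigr (fun i => (tnth (noise xi w) i - h i lam) ^+ 2))// => i _.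
  rewrite YE fitE tnth_mktuple; congr (_ ^+ 2).
  by rewrite opprD addrACA subrr add0r.
have ewaE w i : ewa x phi beta prior (Y ^~ w) (x i) - f (x i) =
    posterior_moment mu beta h i 1 (noise xi w).
  have ZE : \int[prior]_lam gibbs_weight x phi beta (Y ^~ w) lam =
      partition_function mu beta h (noise xi w).
    by apply: eq_Rintegral => lam _; exact: gibbsE.
  have -> : ewa x phi beta prior (Y ^~ w) (x i) = f (x i) +
      posterior_moment mu beta h i 1 (noise xi w).
    rewrite -(integral_gibbs_affine sigma_gt0 beta_ge mh Z_ge).
    by apply: eq_Rintegral => lam _; rewrite /theta ZE gibbsE fitE.
  by rewrite addrC addKr.
pose risk_sum w := (\sum_i posterior_moment mu beta h i 1 (noise xi w) ^+ 2)%:E.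
have risk_sum_ge0 w : [set: Omega] w -> (0 <= risk_sum w)%E.
  by move=> _; rewrite lee_fin sumr_ge0// => i _; exact: sqr_ge0.
have mrisk_sum : measurable_fun [set: Omega] risk_sum.
  apply/measurable_EFinP/measurable_sum => i; apply: measurable_funX.
  exact: (measurableT_comp (measurable_posterior_moment mh Z_ge i 1)
    (measurable_noise xi)).
have ninv_ge0 : 0 <= n%:R^-1 :> R by rewrite invr_ge0 ltW.
have -> : ('E_P [fun w => sqnorm_n
      (fun i => ewa x phi beta prior (Y ^~ w) (x i) - f (x i))%R] =
    (n%:R^-1)%:E * \int[P]_w risk_sum w)%E.
  rewrite unlock -(ge0_integralZl_EFin _ measurableT risk_sum_ge0 mrisk_sum)//.
  apply: eq_integral => w _; rewrite /sqnorm_n -EFinM; congr ((_ * _)%:E).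
  by apply: eq_bigr => i _; rewrite ewaE.
apply: (@le_trans _ _ ((n%:R^-1)%:E * C%:E)%E).
  by rewrite lee_wpmul2l// lee_fin.
rewrite -EFinM lee_fin /C mulrDr (mulrC n%:R^-1 (sigma ^+ 2)) lerD2r.
have := shift_cost_le lamstar tau_gt0.
have -> : l1norm lamstar / (tau * (sparsity lamstar)%:R) =
    r / ((sparsity lamstar)%:R * sigma) * l1norm lamstar.
  rewrite tauE invfM invf_div invfM; ring.
set b := logp _ => le.
have -> : 4 * beta / n%:R * (sparsity lamstar)%:R * (1 + b) =
    n%:R^-1 * (beta * (4 * (sparsity lamstar)%:R * (1 + b))) by ring.
by rewrite ler_pM2l ?invr_gt0// ler_pM2l.
Qed.
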